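(* Let $k\ge3$ and let $t\in V_1\otimes\cdots\otimes V_k$ be a free complex tensor. Let $\theta\in\mathcal{P}([k])$. Then $\rho^\theta(t)=E^\theta(t)=E_\theta(t)$.
   Context: All vector spaces finite-dimensional complex, $\dim V_i=n_i$; $H$ is Shannon (base 2) or von Neumann entropy. For a $k$-tuple $C$ of bases of $V_1,\dots,V_k$ (indexed by $[n_i]$), $\operatorname{supp}_Ct$ is the set of index tuples $\alpha$ whose coefficient of $v_{1,\alpha_1}\otimes\cdots\otimes v_{k,\alpha_k}$ in $t$ is nonzero. A set $\Phi\subseteq I_1\times\cdots\times I_k$ is free if any two distinct elements differ in at least two coordinates; $t$ is free if $\operatorname{supp}_Ct$ is free for some $C$. $\rho^\theta(t)=\min_C\max_{P\in\mathcal{P}(\operatorname{supp}_Ct)}\sum_i\theta(i)H(P_i)$ ($P_i$ marginals). Upper quantum functional: $E^\theta(t)=\sup\sum_j\theta(j)H(\overline{\lambda^{(j)}})$ over all $m\ge1$, $\lambda^{(j)}\vdash m$ with $(P^{V_1}_{\lambda^{(1)}}\otimes\cdots\otimes P^{V_k}_{\lambda^{(k)}})t^{\otimes m}\ne0$, where $P^V_\lambda$ projects $V^{\otimes m}$ onto the $\lambda$-isotypic component of $V^{\otimes m}\cong\bigoplus_{\lambda\vdash m}\mathbb{S}_\lambda(V)\otimes[\lambda]$ and $\overline\lambda=(\lambda_1/m,\dots)$. Lower quantum functional: with inner products on the $V_j$, for nonzero $\psi$ let $\rho=|\psi\rangle\langle\psi|/\langle\psi|\psi\rangle$ with one-party marginals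 $\rho_j$; $E_\theta(t)=\sup_{A_j\in\mathrm{GL}(V_j)}\sum_j\theta(j)H(\rho_j)$ evaluated at $\psi=(A_1\otimes\cdots\otimes A_k)t$. *)

(* Defs.v *)
From HB Require Import structures.
From mathcomp Require Import all_boot all_order all_algebra all_fingroup.
From mathcomp Require Import spectral complex.
From mathcomp Require Import all_classical all_reals all_analysis.

Set Implicit Arguments.
Unset Strict Implicit.
Unset Printing Implicit Defensive.

Import Order.TTheory GRing.Theory Num.Theory.

Local Open Scope classical_set_scope.
Local Open Scope ring_scope.

Section Entropy.
Variable R : realType.

Definition is_dist (T : finType) (p : T -> R) : Prop :=
  (forall x, 0 <= p x) /\ \sum_x p x = 1.

(* 0 * log2 0 = 0, since [ln 0 = 0] in the library *)
Definition entropy (T : finType) (p : T -> R) : R :=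
  - \sum_x p x * (ln (p x) / ln 2).

Definition vn_entropy (d : nat) (rho : 'M[R[i]]_d) : R :=
  entropy (fun a : 'I_d => complex.Re (spectral_diag rho 0 a)).

End Entropy.

Section Tensors.
Variable R : realType.
Local Notation C := (R[i]).

(* C^o rather than C: R[i] is canonically an R-module, and the values have to
   form a vector space over R[i]. *)
Definition space (T : finType) := {ffun T -> C^o}.

Definition midx (k : nat) (I : 'I_k -> finType) := {dffun forall j, I j}.

(* The tensor product of the spaces [space (I j)], in coordinates. *)
Definition tens (k : nat) (I : 'I_k -> finType) := space (midx I).

(* V_0 (x) ... (x) V_(k-1) with V_j = C^(n j) *)
Definition tensor (k : nat) (n : 'I_k -> nat) :=
  tens (fun j => 'I_(n j) : finType).

(* (A_0 (x) ... (x) A_(k-1)) t, where A_j has matrix entries [A j a b]. *)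
Definition tmap (k : nat) (I : 'I_k -> finType) (A : forall j, I j -> I j -> C)
    (t : tens I) : tens I :=
  [ffun a : midx I => \sum_(b : midx I) (\prod_j A j (a j) (b j)) * t b].

Lemma bigA_distr_midx (k : nat) (I : 'I_k -> finType)
    (F : forall j, I j -> C) :
  \prod_j \sum_(x : I j) F j x = \sum_(a : midx I) \prod_j F j (a j).
Proof.
pose F' j := [ffun x => F j x].
have -> : \prod_j \sum_(x : I j) F j x = \prod_j
    \sum_(g in tagged_with I j) untag 0 (F' j) g.
  apply: eq_bigr => j _; rewrite -(big_tag F'); apply: eq_bigr => x _; by rewrite ffunE.
rewrite bigA_distr_big_dep -big_fprod.
rewrite (reindex (@dffun_of_fprod _ I)) /=; last first.
  by exists (@fprod_of_dffun _ I) => x _;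
    rewrite ?fprod_of_dffunK ?dffun_of_fprodK.
by apply: eq_bigr => f _; apply: eq_bigr => j _; rewrite !ffunE.
Qed.

End Tensors.

Section SupportFunctional.
Variable R : realType.
Local Notation C := (R[i]).
Variables (k : nat) (n : 'I_k -> nat).
Local Notation idx := (midx (fun j => 'I_(n j) : finType)).

(* A k-tuple of bases: the basis of C^(n j) consists of the columns of B j. *)
Definition is_bases (B : forall j, 'M[C]_(n j)) : Prop :=
  forall j, B j \in unitmx.

Definition basis_tensor (B : forall j, 'M[C]_(n j)) (a : idx) : tensor R n :=
  [ffun b : idx => \prod_j B j (b j) (a j)].

(* Coefficients of t in the product basis [basis_tensor B], see [tcoefP]. *)
Definition tcoef (B : forall j, 'M[C]_(n j)) (t : tensor R n) : tensor R n :=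
  tmap (fun j => invmx (B j)) t.

Lemma tcoefP (B : forall j, 'M[C]_(n j)) (t : tensor R n) :
  is_bases B -> t = \sum_(a : idx) (tcoef B t a : C) *: basis_tensor B a.
Proof.
move=> Bb; apply/ffunP => b; rewrite sum_ffunE.
under eq_bigr => a _ do rewrite !ffunE scaler_suml.
rewrite exchange_big /=.
under eq_bigr => c _.
  under eq_bigr => a _ do rewrite -[_ *: _]/(_ * _) mulrAC -big_split /=.
  rewrite -mulr_suml.
  rewrite -(bigA_distr_midx (fun j x => invmx (B j) x (c j) * B j (b j) x)).
  under eq_bigr => j _.
    under eq_bigr => x _ do rewrite mulrC.
    have -> : \sum_x B j (b j) x * invmx (B j) x (c j) = (b j == c j)%:R.
      have := congr1 (fun M : 'M[C]_(n j) => M (b j) (c j)) (mulmxV (Bb j)).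
      by rewrite !mxE.
  over.
over.
rewrite (bigD1 b) //= -[LHS]addr0; apply: esym; congr (_ + _).
  by rewrite big1 ?mul1r // => j _; rewrite eqxx.
apply: big1 => c cb.
case: (pickP (fun j => b j != c j)) => [j /negPf bcj|eq_bc].
  by rewrite (bigD1 j) //= bcj !mul0r.
case/eqP: cb; apply/ffunP => j; apply/esym/eqP.
by move/negbFE: (eq_bc j).
Qed.

Definition tsupp (B : forall j, 'M[C]_(n j)) (t : tensor R n) : {set idx} :=
  [set a | tcoef B t a != 0].

Definition free_set (Phi : {set idx}) : Prop :=
  forall a b, a \in Phi -> b \in Phi -> a != b ->
    (2 <= #|[pred j | a j != b j]|)%N.

Definition free_tensor (t : tensor R n) : Prop :=
  exists B, is_bases B /\ free_set (tsupp B t).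

Definition dist_on (Phi : {set idx}) (P : idx -> R) : Prop :=
  is_dist P /\ forall a, a \notin Phi -> P a = 0.

Definition marginal (P : idx -> R) (j : 'I_k) (x : 'I_(n j)) : R :=
  \sum_(a : idx | a j == x) P a.

(* The maximum over a simplex; -oo when Phi is empty, i.e. for t = 0. *)
Definition max_entropy (theta : 'I_k -> R) (Phi : {set idx}) : \bar R :=
  ereal_sup [set (\sum_j theta j * entropy (marginal P (j := j)))%:E
            | P in dist_on Phi].

(* The infimum is a minimum: there are only finitely many possible supports. *)
Definition upper_support (theta : 'I_k -> R) (t : tensor R n) : \bar R :=
  ereal_inf [set max_entropy theta (tsupp B t) | B in is_bases].

End SupportFunctional.

Section SpechtModules.
Variable R : realType.
Local Notation C := (R[i]).
Variable m : nat.

Definition is_partition (lam : seq nat) : bool :=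
  [&& sorted geq lam, 0%N \notin lam & sumn lam == m].

Definition galg := space R {perm 'I_m}.

Definition galg_mul (x y : galg) : galg :=
  [ffun u => \sum_(s : {perm 'I_m}) x s * y (s^-1 * u)%g].

Definition galg_act (s : {perm 'I_m}) (x : galg) : galg :=
  [ffun u => x (s^-1 * u)%g].

(* Row and column stabilizers of the tableau of shape lam whose rows are
   filled with 0, 1, ..., m-1 in reading order. *)
Definition row_stab (lam : seq nat) : {set {perm 'I_m}} :=
  [set s : {perm 'I_m} |
    [forall x, reshape_index lam (s x) == reshape_index lam x]].

Definition col_stab (lam : seq nat) : {set {perm 'I_m}} :=
  [set s : {perm 'I_m} |
    [forall x, reshape_offset lam (s x) == reshape_offset lam x]].

Definition young_symmetrizer (lam : seq nat) : galg :=
  [ffun u => \sum_(p in row_stab lam) \sum_(q in col_stab lam | (p * q)%g == u)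
     (-1) ^+ odd_perm q].

(* The Specht module [lam] as a left ideal of the group algebra. *)
Definition specht (lam : seq nat) : set galg :=
  [set x | exists y, x = galg_mul y (young_symmetrizer lam)].

End SpechtModules.

Section UpperQuantum.
Variable R : realType.
Local Notation C := (R[i]).

(* The m-th tensor power of C^d. *)
Definition word (m d : nat) : finType := {ffun 'I_m -> 'I_d}.
Definition tpower (m d : nat) := space R (word m d).

(* Permutation of the tensor factors.  In the library (s * r) x = r (s x), so
   precomposition of words with s^-1 gives a left action, see [act_wordM]. *)
Definition act_word (m d : nat) (s : {perm 'I_m}) (v : tpower m d) :
    tpower m d :=
  [ffun w : word m d => v [ffun x => w ((s^-1)%g x)]].

Lemma act_wordM (m d : nat) (s r : {perm 'I_m}) (v : tpower m d) :
  act_word (s * r)%g v = act_word s (act_word r v).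
Proof.
apply/ffunP => w; rewrite !ffunE; congr (v _).
by apply/ffunP => x; rewrite !ffunE invMg permM.
Qed.

(* The restriction of f to [lam] commutes with the actions of S_m. *)
Definition intertwiner (m d : nat) (lam : seq nat)
    (f : 'Hom(galg R m, tpower m d)) : Prop :=
  forall s x, specht lam x -> f (galg_act s x) = act_word s (f x).

(* The lam-isotypic component: the sum of the images of all homomorphisms of
   S_m-modules from [lam] to the tensor power, i.e. the image of
   Hom_(S_m)([lam], V^(x)m) (x) [lam] in V^(x)m. *)
Definition isotypic (m d : nat) (lam : seq nat) : set (tpower m d) :=
  [set v | exists (r : nat) (f : 'I_r -> 'Hom(galg R m, tpower m d))
                  (x : 'I_r -> galg R m),
      [/\ forall i, intertwiner lam (f i), forall i, specht lam (x i)
        & v = \sum_i f i (x i)]].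

(* P is the projection onto the lam-isotypic component along the others; this
   determines P because the tensor power is the direct sum of them. *)
Definition isotypic_proj (m d : nat) (lam : seq nat)
    (P : 'End(tpower m d)) : Prop :=
  (forall v, isotypic lam v -> P v = v) /\
  (forall mu v, is_partition m mu -> mu != lam -> isotypic mu v -> P v = 0).

Definition end_entry (T : finType) (f : 'End(space R T)) (a b : T) : C :=
  f [ffun c => (c == b)%:R] a.

Variables (k : nat) (n : 'I_k -> nat).

(* t^(x)m, as an element of V_0^(x)m (x) ... (x) V_(k-1)^(x)m *)
Definition tens_pow (m : nat) (t : tensor R n) :
    tens R (fun j => word m (n j)) :=
  [ffun w : midx (fun j => word m (n j)) =>
     \prod_(x < m) t [ffun j => w j x]].

Definition part_entropy (m : nat) (lam : seq nat) : R :=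
  entropy (fun i : 'I_(size lam) => (nth 0%N lam i)%:R / m%:R).

(* Equal to -oo for t = 0. *)
Definition upper_quantum (theta : 'I_k -> R) (t : tensor R n) : \bar R :=
  ereal_sup [set e | exists (m : nat) (lam : 'I_k -> seq nat)
                            (P : forall j, 'End(tpower m (n j))),
    [/\ (0 < m)%N,
        forall j, is_partition m (lam j),
        forall j, isotypic_proj (lam j) (P j),
        tmap (fun j => end_entry (P j)) (tens_pow m t) != 0
      & e = (\sum_j theta j * part_entropy m (lam j))%:E]].

End UpperQuantum.

Section LowerQuantum.
Variable R : realType.
Local Notation C := (R[i]).
Variables (k : nat) (n : 'I_k -> nat).
Local Notation idx := (midx (fun j => 'I_(n j) : finType)).

(* Entries of |psi><psi| / <psi|psi> for the standard inner products *)
Definition density (psi : tensor R n) (a b : idx) : C :=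
  psi a * (psi b)^* / \sum_(c : idx) psi c * (psi c)^*.

(* Partial trace over all tensor factors but the j-th *)
Definition reduced_density (psi : tensor R n) (j : 'I_k) : 'M[C]_(n j) :=
  \matrix_(x, y) \sum_(a : idx | a j == x)
    \sum_(b : idx | (b j == y) && [forall l, (l != j) ==> (a l == b l)])
      density psi a b.

(* Equal to -oo for t = 0, since psi has to be nonzero. *)
Definition lower_quantum (theta : 'I_k -> R) (t : tensor R n) : \bar R :=
  ereal_sup [set e | exists A : forall j, 'M[C]_(n j),
    let psi := tmap (fun j => A j) t in
    [/\ forall j, A j \in unitmx,
        psi != 0
      & e = (\sum_j theta j * vn_entropy (reduced_density psi j))%:E]].

End LowerQuantum.

(* Main.v *)
From HB Require Import structures.
Require Import Defs.
From mathcomp Require Import all_boot all_order all_algebra all_fingroup.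
From mathcomp Require Import spectral complex.
From mathcomp Require Import all_classical all_reals all_analysis.
From mathcomp Require Import ring lra.

(** Write rho, E^, E_ for the support functional and the upper and lower quantum
    functionals; the inequalities rho <= E_ <= E^ <= rho are proved in turn, and only
    the first one uses freeness.

    E^ <= rho (any basis): the projection onto the lam-isotypic component is the
    action of a central idempotent lying in the two-sided ideal generated by the Young
    symmetrizer of lam.  It kills a word unless lam dominates the letter counts of the
    word, and dominance decreases entropy; the words occurring in t^(x)m give
    empirical distributions on the support of t.

    rho <= E_ (free basis): the reduced densities of a tensor with free support are
    diagonal, so rescaling the basis vectors realises an exponential family on the
    support, whose marginals come arbitrarily close to those of any distribution on
    the support.

    E_ <= E^ (spectrum estimation): if r is the spectrum of the j-th reduced density
    of psi, the lam-component of psi^(x)m in the j-th factor has squared norm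
    tr(P_lam diag(r)^(x)m).  As P_lam has rank at most poly(m) 2^(m H(lam/m)), shapes
    with H(lam/m) < H(r) - eps carry exponentially little weight, and there are
    polynomially many of them, so some tuple of shapes of large entropy survives. *)

Set Implicit Arguments.
Unset Strict Implicit.
Unset Printing Implicit Defensive.

Import Order.TTheory GRing.Theory Num.Theory.

Local Open Scope ring_scope.

(** * The group algebra of the symmetric group *)

(** All facts about an isotypic component come from one element, [iso_idem]: the orthogonal
    projection of 1 onto the two-sided ideal of the Young symmetrizer, for the inner product
    [gtr (x * gstar y)]. Orthogonality makes it invariant under conjugation, a left unit of the
    ideal and self-adjoint, and self-adjointness turns its diagonal entries on words into sums of
    squares, hence weights in [0, 1]. That these idempotents add up to 1 is a count: distinct shapes
    give orthogonal nonzero ideals, and there are no more conjugacy classes than shapes.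

    The suprema need not be attained, so the two lower bounds are proved up to eps. An exponential
    family reaches a distribution of smaller support only in the limit, hence the use of
    near-minimisers of a convex function. In spectrum estimation the product measure is compared
    with its (1+s)-th power: the cost s^2 K, with K the second moment of ln r, has to stay below the
    gain s del, and this fixes s. *)

Definition ga (R : realType) (m : nat) := galg R m.

Section GroupAlgebra.
Variables (R : realType) (m : nat).
Local Notation C := (R[i]).
Local Notation G := {perm 'I_m}.

(** The name [ga] carries convolution as its ring product; [galg] keeps the vector space structure
    in which spans are formed. *)
HB.instance Definition _ := GRing.Lmodule.copy (ga R m) (galg R m).

Definition gdel (s : G) : ga R m := [ffun u => (u == s)%:R].

Lemma ga_mulA : associative (@galg_mul R m).
Proof.
move=> x y z; apply/ffunP => u; rewrite !ffunE.
under eq_bigr => s _ do rewrite ffunE mulr_sumr.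
under [RHS]eq_bigr => s _ do rewrite ffunE mulr_suml.
rewrite [RHS]exchange_big /=; apply: eq_bigr => s _.
rewrite [RHS](reindex_inj (mulgI s)) /=; apply: eq_bigr => r _.
by rewrite mulrA mulKg invMg mulgA.
Qed.

Lemma ga_mul1 : left_id (gdel 1) (@galg_mul R m).
Proof.
move=> x; apply/ffunP => u; rewrite !ffunE (bigD1 1%g) //= ffunE eqxx mul1r.
rewrite invg1 mul1g big1 ?addr0 // => s /negPf s1.
by rewrite ffunE s1 mul0r.
Qed.

Lemma ga_mulr1 : right_id (gdel 1) (@galg_mul R m).
Proof.
move=> x; apply/ffunP => u; rewrite !ffunE (bigD1 u) //= ffunE mulVg eqxx mulr1.
rewrite big1 ?addr0 // => s /negPf su.
by rewrite ffunE -eq_mulVg1 su mulr0.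
Qed.

Lemma ga_mulDl : left_distributive (@galg_mul R m) +%R.
Proof.
move=> x y z; apply/ffunP => u; rewrite !ffunE -big_split /=.
by apply: eq_bigr => s _; rewrite ffunE mulrDl.
Qed.

Lemma ga_mulDr : right_distributive (@galg_mul R m) +%R.
Proof.
move=> x y z; apply/ffunP => u; rewrite !ffunE -big_split /=.
by apply: eq_bigr => s _; rewrite ffunE mulrDr.
Qed.

Lemma ga_oner_neq0 : gdel 1 != 0.
Proof.
by apply/eqP => /ffunP /(_ 1%g) /eqP; rewrite !ffunE eqxx oner_eq0.
Qed.

HB.instance Definition _ := GRing.Zmodule_isNzRing.Build (ga R m)
  ga_mulA ga_mul1 ga_mulr1 ga_mulDl ga_mulDr ga_oner_neq0.

Lemma ga_scaleAl (a : C) (x y : ga R m) : a *: (x * y) = (a *: x) * y.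
Proof.
apply/ffunP => u; rewrite !ffunE scaler_sumr.
by apply: eq_bigr => s _; rewrite ffunE -[_ *: _]/(_ * _) mulrA.
Qed.

Lemma ga_scaleAr (a : C) (x y : ga R m) : a *: (x * y) = x * (a *: y).
Proof.
apply/ffunP => u; rewrite !ffunE scaler_sumr.
by apply: eq_bigr => s _; rewrite ffunE -[_ *: _]/(_ * _) mulrCA.
Qed.

HB.instance Definition _ := GRing.Lmodule_isLalgebra.Build C (ga R m) ga_scaleAl.
HB.instance Definition _ := GRing.Lalgebra_isAlgebra.Build C (ga R m) ga_scaleAr.

Implicit Types (x y z : ga R m) (s r : G).

Lemma ga_mulE x y s : (x * y) s = \sum_r x r * y (r^-1 * s)%g.
Proof. by rewrite ffunE. Qed.

Lemma gdel1 : gdel 1%g = 1.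
Proof. by []. Qed.

Lemma gdel_mulE s x r : (gdel s * x) r = x (s^-1 * r)%g.
Proof.
rewrite ga_mulE (bigD1 s) //= ffunE eqxx mul1r big1 ?addr0 // => u /negPf us.
by rewrite ffunE us mul0r.
Qed.

Lemma mul_gdelE s x r : (x * gdel s) r = x (r * s^-1)%g.
Proof.
rewrite ga_mulE (bigD1 (r * s^-1)%g) //= ffunE invMg invgK mulgKV eqxx mulr1.
rewrite big1 ?addr0 // => u urs; rewrite ffunE.
case: eqP => [eq_s|]; last by rewrite mulr0.
by case/eqP: urs; rewrite -eq_s invMg invgK mulKVg.
Qed.

Lemma gdelM s r : gdel (s * r) = gdel s * gdel r.
Proof.
by apply/ffunP => u; rewrite mul_gdelE !ffunE (can2_eq (mulgKV r) (mulgK r)).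
Qed.

Lemma ga_sumE (I : Type) (l : seq I) (P : pred I) (F : I -> ga R m) s :
  (\sum_(i <- l | P i) F i) s = \sum_(i <- l | P i) F i s.
Proof.
by apply: (big_morph (fun x : ga R m => x s)) => [x y|]; rewrite ffunE.
Qed.

Lemma ga_scaleE (a : C) x s : (a *: x) s = a * x s.
Proof. by rewrite ffunE. Qed.

Lemma ga_subE x y s : (x - y) s = x s - y s.
Proof. by rewrite !ffunE. Qed.

Lemma ga_0E s : (0 : ga R m) s = 0.
Proof. by rewrite ffunE. Qed.

Lemma gdelE s r : gdel s r = (r == s)%:R.
Proof. by rewrite ffunE. Qed.

Lemma ga_sum x : x = \sum_s x s *: gdel s.
Proof.
apply/ffunP => u; rewrite ga_sumE.
transitivity (\sum_s x s * (u == s)%:R); last first.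
  by apply: eq_bigr => s _; rewrite -(gdelE s u); exact/esym/ga_scaleE.
rewrite (bigD1 u) //= eqxx mulr1 big1 ?addr0 // => s /negPf su.
by rewrite eq_sym su mulr0.
Qed.

Definition gtr x : C := x 1%g.

Lemma gtrC x y : gtr (x * y) = gtr (y * x).
Proof.
rewrite /gtr !ga_mulE (reindex_inj invg_inj) /=.
by apply: eq_bigr => s _; rewrite invgK !mulg1 mulrC.
Qed.

(** The involution for which [gtr (x * gstar y)] is the standard Hermitian form; multiplication by
    [gstar x] is adjoint to multiplication by [x]. *)
Definition gstar x : ga R m := [ffun s => (x s^-1%g)^*].

Lemma gstarM x y : gstar (x * y) = gstar y * gstar x.
Proof.
apply/ffunP => s; rewrite !ffunE rmorph_sum /=.
rewrite [LHS](reindex_inj (mulgI s^-1%g)) /=.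
apply: eq_bigr => r _; rewrite !ffunE rmorphM /= mulrC !invMg !invgK.
by rewrite mulgK.
Qed.

Lemma gstarK x : gstar (gstar x) = x.
Proof. by apply/ffunP => s; rewrite !ffunE invgK conjCK. Qed.

Lemma gstarB x y : gstar (x - y) = gstar x - gstar y.
Proof. by apply/ffunP => s; rewrite !ffunE rmorphB. Qed.

Lemma gstarE x s : gstar x s = (x s^-1%g)^*.
Proof. by rewrite ffunE. Qed.

Lemma gstar0 : gstar 0 = 0.
Proof. by rewrite -[X in gstar X](subrr 0) gstarB subrr. Qed.

Lemma gstar_del s : gstar (gdel s) = gdel s^-1.
Proof.
by apply/ffunP => r; rewrite !ffunE rmorph_nat (can2_eq invgK invgK).
Qed.

Lemma gtr_starE x y : gtr (x * gstar y) = \sum_s x s * (y s)^*.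
Proof.
rewrite /gtr ga_mulE; apply: eq_bigr => s _.
by rewrite ffunE invMg invgK invg1 mul1g.
Qed.

Lemma gtr_star_eq0 x : gtr (x * gstar x) = 0 -> x = 0.
Proof.
rewrite gtr_starE => x0; apply/ffunP => s; rewrite ffunE.
have /allP /(_ s) : all (fun s => true ==> (x s * (x s)^* == 0)) (index_enum G).
  rewrite -psumr_eq0 ?x0 ?eqxx// => r _; exact: mul_conjC_ge0.
by rewrite mem_index_enum => /(_ isT); rewrite mul_conjC_eq0 => /eqP.
Qed.

Lemma gtr_star_del x : (forall s, gtr (x * gdel s) = 0) -> x = 0.
Proof.
move=> x0; apply/ffunP => s; rewrite [RHS]ffunE -(x0 s^-1%g).
by rewrite /gtr mul_gdelE invgK mul1g.
Qed.

(** Gram-Schmidt: the generator [x] enters only through its component [x'] orthogonal to the span of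
    the earlier ones. If [x'] is 0, the coefficient [c] is 0 by the convention for division. *)
Lemma orth_proj_exists (X : seq (galg R m)) (v : galg R m) :
  exists2 p, p \in <<X>>%VS & forall y, y \in <<X>>%VS ->
    gtr ((v - p : ga R m) * gstar y) = 0.
Proof.
elim: X v => [|x X IHX] v.
  exists 0; first exact: mem0v.
  move=> y; rewrite span_nil memv0 => /eqP ->.
  by rewrite gstar0 mulr0 /gtr ga_0E.
have linr (a b : C) (u w y : ga R m) :
    gtr (y * gstar (a *: u + b *: w)) =
    a^* * gtr (y * gstar u) + b^* * gtr (y * gstar w).
  rewrite !gtr_starE !mulr_sumr -big_split /=; apply: eq_bigr => s _.
  rewrite ffunE (ga_scaleE a) (ga_scaleE b).
  rewrite rmorphD !rmorphM /= mulrDr; congr (_ + _); exact: mulrCA.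
have [q qX qP] := IHX x; have [p pX pP] := IHX v.
set x' : ga R m := x - q; set v' : ga R m := v - p.
have XxX y : y \in <<X>>%VS -> y \in <<x :: X>>%VS.
  by rewrite span_cons => yX; apply: subvP yX; apply: addvSr.
have xxX : x \in <<x :: X>>%VS by apply: memv_span; rewrite mem_head.
pose c := gtr (v' * gstar x') / gtr (x' * gstar x').
exists (p + c *: x').
  apply: (@memvD _ (galg R m)); first exact: XxX.
  apply: (@memvZ _ (galg R m)); apply: (@memvB _ (galg R m)) => //; exact: XxX.
move=> y; rewrite span_cons => /memv_addP [u /vlineP [a ->] [w wX ->]].
have -> : v - (p + c *: x') = v' - c *: x' by rewrite opprD addrA.
have -> : a *: x + w = a *: x' + 1 *: (a *: q + w).
  by rewrite scale1r addrA -scalerDr subrK.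
have wq : a *: q + w \in <<X>>%VS by apply: (@memvD _ (galg R m)) => //;
  apply: (@memvZ _ (galg R m)).
have trB (z1 z2 : ga R m) : gtr ((v' - c *: z1) * z2) =
    gtr (v' * z2) - c * gtr (z1 * z2).
  by rewrite mulrBl -scalerAl /gtr ga_subE (ga_scaleE c).
rewrite linr !trB (pP _ wq) (qP _ wq) mulr0 subrr mulr0 addr0 /c.
have [x0|x0] := eqVneq (gtr (x' * gstar x')) 0.
  by rewrite (gtr_star_eq0 x0) gstar0 !mulr0 /gtr ga_0E mulr0 subrr mulr0.
by rewrite divfK // subrr mulr0.
Qed.

End GroupAlgebra.

(** * Two-sided ideals and their central idempotents *)

Section TwoSidedIdeals.
Variables (R : realType) (m : nat).
Local Notation C := (R[i]).
Local Notation G := {perm 'I_m}.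
Local Notation ga := (ga R m).
Implicit Types (c e x y z : ga) (s r g h : G).

Definition translates c : seq (galg R m) :=
  [seq gdel R gh.1 * c * gdel R gh.2 | gh <- enum [set: G * G]].

Definition two_sided c : {vspace galg R m} := <<translates c>>%VS.

(** This explicit form lets vanishing and rank statements about the ideal be checked on single
    translates of [c]. *)
Lemma two_sidedP c x :
  x \in two_sided c <-> exists beta : G -> G -> C,
    x = \sum_g \sum_h beta g h *: (gdel R g * c * gdel R h).
Proof.
split=> [xJ|[beta ->]].
  pose X := translates c.
  have sz : size X = #|{: G * G}| by rewrite size_map -cardsT cardE.
  exists (fun g h => coord (in_tuple X) (cast_ord (esym sz) (enum_rank (g, h))) x).
  rewrite pair_big /= [LHS](@coord_span _ _ _ (in_tuple X)) //=.
  rewrite (reindex (fun gh : G * G => cast_ord (esym sz) (enum_rank gh))) /=.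
    apply: eq_bigr => -[g h] _ /=; congr (_ *: _).
    rewrite (nth_map (1%g, 1%g)) -?cardE ?cardsT ?ltn_ord // enum_setT -enumT.
    by rewrite -[nth _ _ _]/(nth _ _ (enum_rank (g, h))) nth_enum_rank.
  exists (fun i => enum_val (cast_ord sz i)) => [gh|i] _.
    by rewrite cast_ordKV enum_rankK.
  by rewrite enum_valK cast_ordK.
apply: memv_suml => g _; apply: memv_suml => h _.
apply: memvZ; apply: memv_span; apply/mapP.
by exists (g, h); rewrite ?mem_enum ?inE.
Qed.

Lemma two_sided_gen c : c \in two_sided c.
Proof.
apply: memv_span; apply/mapP; exists (1%g, 1%g); first by rewrite mem_enum ?inE.
by rewrite /= gdel1 mul1r mulr1.
Qed.

Lemma two_sided_mull c x y : y \in two_sided c -> x * y \in two_sided c.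
Proof.
case/two_sidedP => beta ->; rewrite [x]ga_sum mulr_suml.
apply: memv_suml => s _; rewrite -scalerAl; apply: memvZ.
rewrite mulr_sumr; apply: memv_suml => g _.
rewrite mulr_sumr; apply: memv_suml => h _.
rewrite -scalerAr; apply: memvZ; rewrite !mulrA -gdelM.
by apply: memv_span; apply/mapP; exists ((s * g)%g, h); rewrite ?mem_enum ?inE.
Qed.

Lemma two_sided_mulr c x y : y \in two_sided c -> y * x \in two_sided c.
Proof.
case/two_sidedP => beta ->; rewrite [x]ga_sum mulr_sumr.
apply: memv_suml => s _; rewrite -scalerAr; apply: memvZ.
rewrite mulr_suml; apply: memv_suml => g _.
rewrite mulr_suml; apply: memv_suml => h _.
rewrite -scalerAl; apply: memvZ; rewrite -!mulrA -gdelM mulrA.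
by apply: memv_span; apply/mapP; exists (g, (h * s)%g); rewrite ?mem_enum ?inE.
Qed.

Lemma two_sided_idem_exists c : exists e : ga,
  e \in two_sided c /\ forall y, y \in two_sided c -> gtr ((1 - e) * gstar y) = 0.
Proof.
have [e eJ eP] := orth_proj_exists
  (translates c) (1 : ga).
by exists e; split=> // y /eP.
Qed.

Definition two_sided_idem c : ga := sval (cid (two_sided_idem_exists c)).

Lemma two_sided_idem_in c : two_sided_idem c \in two_sided c.
Proof. by have [] := svalP (cid (two_sided_idem_exists c)). Qed.

Lemma two_sided_idem_orth c y : y \in two_sided c ->
  gtr ((1 - two_sided_idem c) * gstar y) = 0.
Proof. by have [_] := svalP (cid (two_sided_idem_exists c)); apply. Qed.

Lemma two_sided_idem_uniq c e : e \in two_sided c ->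
  (forall y, y \in two_sided c -> gtr ((1 - e) * gstar y) = 0) ->
  e = two_sided_idem c.
Proof.
move=> eJ eP; set e' := two_sided_idem c.
have dJ : e - e' \in two_sided c by apply: memvB => //; apply: two_sided_idem_in.
suff /eqP : (e - e' : ga) = 0 by rewrite subr_eq0 => /eqP.
apply: gtr_star_eq0.
have -> : (e - e') * gstar (e - e') =
    (1 - e') * gstar (e - e') - (1 - e) * gstar (e - e').
  by rewrite -mulrBl opprB [1 - e' + _]addrC addrA subrK.
by rewrite {1}/gtr ga_subE -!/(gtr _) eP // two_sided_idem_orth // subrr.
Qed.

(** Conjugation preserves both the ideal and the inner product, so it fixes the projection of 1. *)
Lemma two_sided_idem_conj c s :
  gdel R s * two_sided_idem c * gdel R s^-1 = two_sided_idem c.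
Proof.
have ss : gdel R s * gdel R s^-1 = 1 by rewrite -gdelM mulgV.
apply: two_sided_idem_uniq => [|y yJ].
  exact/two_sided_mulr/two_sided_mull/two_sided_idem_in.
set e := two_sided_idem c.
have -> : 1 - gdel R s * e * gdel R s^-1 = gdel R s * (1 - e) * gdel R s^-1.
  by rewrite mulrBr mulr1 mulrBl ss.
rewrite -!mulrA gtrC -!mulrA.
have -> : gdel R s^-1 * (gstar y * gdel R s) = gstar (gdel R s^-1 * y * gdel R s).
  by rewrite !gstarM !gstar_del invgK.
exact/two_sided_idem_orth/two_sided_mulr/two_sided_mull.
Qed.

Lemma two_sided_idem_class c s r :
  two_sided_idem c (s * r * s^-1)%g = two_sided_idem c r.
Proof.
rewrite -{1}(two_sided_idem_conj c s) mul_gdelE invgK gdel_mulE.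
by rewrite -!mulgA mulVg mulg1 mulKg.
Qed.

(** The squared norm of (1 - e) z is the inner product of 1 - e with (1 - e) z z*, an element of the
    ideal, so it vanishes. *)
Lemma two_sided_idemK c z : z \in two_sided c -> two_sided_idem c * z = z.
Proof.
move=> zJ; set e := two_sided_idem c.
have ozJ : (1 - e) * z \in two_sided c by exact: two_sided_mull.
suff : (1 - e) * z = 0 by rewrite mulrBl mul1r => /eqP; rewrite subr_eq0 => /eqP.
apply: gtr_star_eq0; rewrite -mulrA.
have -> : z * gstar ((1 - e) * z) = gstar ((1 - e) * z * gstar z).
  by rewrite !gstarM gstarK.
exact/two_sided_idem_orth/two_sided_mulr.
Qed.

(** Since 1 - e is orthogonal to every translate of e, (1 - e) e* = 0. Thus e* = e e*, and the right
    side is self-adjoint. *)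
Lemma two_sided_idem_star c : gstar (two_sided_idem c) = two_sided_idem c.
Proof.
set e := two_sided_idem c.
have eE : gstar e = e * gstar e.
  suff : (1 - e) * gstar e = 0.
    by rewrite mulrBl mul1r => /eqP; rewrite subr_eq0 => /eqP.
  apply: gtr_star_del => s; rewrite -mulrA.
  have -> : gstar e * gdel R s = gstar (gdel R s^-1 * e).
    by rewrite gstarM gstar_del invgK.
  exact/two_sided_idem_orth/two_sided_mull/two_sided_idem_in.
by rewrite eE -{1}[e]gstarK -gstarM -eE gstarK.
Qed.

Lemma two_sided_idem_idem c :
  two_sided_idem c * two_sided_idem c = two_sided_idem c.
Proof. exact/two_sided_idemK/two_sided_idem_in. Qed.

Lemma two_sided_idem_orthogonal c c' z :
  (forall x, c * x * c' = 0) -> z \in two_sided c' -> two_sided_idem c * z = 0.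
Proof.
move=> cc'; case/two_sidedP => beta ->.
have /two_sidedP [alpha ->] := two_sided_idem_in c.
rewrite mulr_suml big1 // => g _; rewrite mulr_suml big1 // => h _.
rewrite mulr_sumr big1 // => g' _; rewrite mulr_sumr big1 // => h' _.
rewrite -scalerAl -scalerAr; set z1 := _ * _.
have -> : z1 = gdel R g * (c * (gdel R h * gdel R g') * c') * gdel R h'.
  by rewrite /z1 !mulrA.
by rewrite cc' mulr0 mul0r !scaler0.
Qed.

(* The central idempotents are linearly independent elements of the centre, whose
   dimension is the number of conjugacy classes. *)
Lemma sum_two_sided_idem (I : finType) (c : I -> ga) (ty : G -> I) :
  (forall i, c i != 0) -> (forall i j x, i != j -> c i * x * c j = 0) ->
  (forall s r, ty s = ty r -> exists g, r = g * s * g^-1)%g ->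
  \sum_i two_sided_idem (c i) = 1.
Proof.
move=> c0 cc conj_ty; pose e i := two_sided_idem (c i).
have ec i j : e i * c j = if i == j then c j else 0.
  case: eqP => [->|/eqP ij]; first exact/two_sided_idemK/two_sided_gen.
  apply: two_sided_idem_orthogonal (two_sided_gen _) => x; exact: cc.
pose rp i : G := odflt 1%g [pick s | ty s == i].
have rpP s : exists g, (s = g * rp (ty s) * g^-1)%g.
  rewrite /rp; case: pickP => [r /eqP /conj_ty //|/(_ s)]; by rewrite eqxx.
have combine (w : 'I_#|I| -> C) j :
    (\sum_i w i *: e (enum_val i)) * c (enum_val j) = w j *: c (enum_val j).
  have ecj i : w i *: e (enum_val i) * c (enum_val j) =
      if i == j then w j *: c (enum_val j) else 0.
    rewrite -scalerAl ec (inj_eq enum_val_inj).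
    by case: eqP => [->|_] //; rewrite scaler0.
  by rewrite mulr_suml (eq_bigr _ (fun i _ => ecj i)) -big_mkcond big_pred1_eq.
(* Values of the idempotents at class representatives. The matrix is square because [I] indexes
   both; independence of the idempotents makes it invertible, so 1 can be expanded in them. *)
pose E : 'M[C]_#|I| := \matrix_(i, j) e (enum_val i) (rp (enum_val j)).
have eE i s : e (enum_val i) s = E i (enum_rank (ty s)).
  by rewrite mxE enum_rankK; have [g {1}->] := rpP s; rewrite two_sided_idem_class.
have sumE (w : 'rV[C]_#|I|) s :
    (\sum_i w 0 i *: e (enum_val i)) s = (w *m E) 0 (enum_rank (ty s)).
  rewrite ga_sumE mxE; apply: eq_bigr => i _.
  by rewrite -eE; exact: ga_scaleE.
have Eu : E \in unitmx.
  rewrite -row_free_unit; apply: inj_row_free => v vE.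
  apply/rowP => j; rewrite mxE.
  have /eqP : v 0 j *: c (enum_val j) = 0.
    rewrite -(combine (fun i => v 0 i)).
    suff -> : \sum_i v 0 i *: e (enum_val i) = 0 by rewrite mul0r.
    by apply/ffunP => s; rewrite sumE vE mxE ga_0E.
  by rewrite scaler_eq0 (negPf (c0 _)) orbF => /eqP.
pose w := (\row_j (rp (enum_val j) == 1%g)%:R : 'rV[C]_#|I|) *m invmx E.
have w1 : \sum_i w 0 i *: e (enum_val i) = 1.
  apply/ffunP => s; rewrite sumE /w mulmxKV // mxE enum_rankK -gdel1 gdelE.
  have [g sE] := rpP s; congr (_%:R); rewrite {2}sE.
  by rewrite -eq_mulgV1 -{2}[g]mulg1 (inj_eq (mulgI g)).
rewrite -[RHS]w1 (reindex (@enum_val _ I)) /=; last first.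
  exact/onW_bij/enum_val_bij.
(* Multiplying the expansion of 1 by a nonzero [c j] leaves only the j-th term and forces its
   coefficient to be 1. *)
apply: eq_bigr => j _; have := combine (fun i => w 0 i) j; rewrite w1 mul1r.
move=> /esym /eqP; rewrite -subr_eq0 -{2}[c _]scale1r -scalerBl scaler_eq0.
by rewrite (negPf (c0 _)) orbF subr_eq0 => /eqP ->; rewrite scale1r.
Qed.

End TwoSidedIdeals.

(** * Young symmetrizers *)

Section Tableaux.
Local Open Scope nat_scope.
Variable m : nat.
Implicit Types (lam mu : seq nat) (x y : 'I_m) (r c : nat).

Definition dominates lam mu := forall i : nat,
  (\sum_(r < i) nth 0 mu r <= \sum_(r < i) nth 0 lam r)%N.

Lemma partition_sum lam : is_partition m lam -> sumn lam = m.
Proof. by case/and3P => _ _ /eqP. Qed.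

Lemma partition_nth_gt0 lam r : is_partition m lam -> (r < size lam)%N ->
  (0 < nth 0 lam r)%N.
Proof.
case/and3P => _ l0 _ rs; rewrite lt0n; apply: contraNneq l0 => <-.
exact: mem_nth.
Qed.

Lemma dominates_anti lam mu : is_partition m lam -> is_partition m mu ->
  dominates lam mu -> dominates mu lam -> lam = mu.
Proof.
move=> pl pm lm ml.
have eq_nth r : nth 0 lam r = nth 0 mu r.
  have eq_sum i : (\sum_(r < i) nth 0 lam r = \sum_(r < i) nth 0 mu r)%N.
    by apply/eqP; rewrite eqn_leq lm ml.
  by have := eq_sum r.+1; rewrite !big_ord_recr /= eq_sum => /addnI.
apply: (@eq_from_nth _ 0) => [|r _]; last exact: eq_nth.
apply/eqP; rewrite eqn_leq; apply/andP; split; rewrite leqNgt; apply/negP.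
  by move=> /(partition_nth_gt0 pl); rewrite eq_nth nth_default.
by move=> /(partition_nth_gt0 pm); rewrite -eq_nth nth_default.
Qed.

Lemma box_inj lam x y :
  reshape_index lam x = reshape_index lam y ->
  reshape_offset lam x = reshape_offset lam y -> x = y.
Proof.
move=> r_xy c_xy; apply/val_inj.
by rewrite /= -(reshape_indexK lam x) -(reshape_indexK lam y) r_xy c_xy.
Qed.

Lemma box_exists lam r c : sumn lam = m -> (c < nth 0 lam r)%N ->
  exists x, reshape_index lam x = r /\ reshape_offset lam x = c.
Proof.
move=> lm cr; have lt_m : (flatten_index lam r c < m)%N.
  rewrite -lm; apply: flatten_indexP => //.
by exists (Ordinal lt_m); rewrite /= flatten_indexKl // flatten_indexKr.
Qed.

Lemma card_row lam r : sumn lam = m ->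
  #|[set x : 'I_m | reshape_index lam x == r]| = nth 0 lam r.
Proof.
move=> lm; have ltm (c : 'I_(nth 0 lam r)) : (flatten_index lam r c < m)%N.
  by rewrite -lm; apply: flatten_indexP.
pose f (c : 'I_(nth 0 lam r)) := Ordinal (ltm c).
rewrite -[RHS]card_ord -cardsT -(card_imset _ (_ : injective f)); last first.
  move=> c d /(congr1 (fun x : 'I_m => reshape_offset lam x)) /=.
  by rewrite !flatten_indexKr // => /val_inj.
apply: eq_card => x; rewrite inE; apply/eqP/imsetP => [xr|[c _ ->]].
  have cx : (reshape_offset lam x < nth 0 lam r)%N.
    by rewrite -xr; apply: reshape_offsetP; rewrite lm.
  exists (Ordinal cx) => //; apply: val_inj.
  by rewrite /= -{1}xr reshape_indexK.
by rewrite /= flatten_indexKl.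
Qed.

Lemma card_rows lam i : sumn lam = m ->
  #|[set x : 'I_m | (reshape_index lam x < i)%N]| = (\sum_(r < i) nth 0 lam r)%N.
Proof.
move=> lm; elim: i => [|i IHi]; first by rewrite big_ord0; apply: eq_card0 => x;
  rewrite inE.
rewrite big_ord_recr /= -IHi -(card_row i lm) -cardsUI.
rewrite [X in _ = _ + X]eq_card0 ?addn0 => [|x]; last first.
  by rewrite !inE; apply/andP => -[lt_i /eqP eq_i]; rewrite eq_i ltnn in lt_i.
by apply: eq_card => x; rewrite !inE ltnS leq_eqVlt orbC.
Qed.

(** A column holds each label at most once, so at most min(size S, its height) of its boxes have
    labels in [S]. Summed over the columns, this minimum counts the boxes in the first size S
    rows. *)
Lemma col_distinct_dominates lam (T : eqType) (phi : 'I_m -> T) (S : seq T) :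
  is_partition m lam ->
  (forall x y, x != y -> reshape_offset lam x = reshape_offset lam y ->
     phi x != phi y) ->
  (#|[set x | phi x \in S]| <= \sum_(r < size S) nth 0 lam r)%N.
Proof.
move=> pl phi_col; have lm := partition_sum pl.
have colm x : (reshape_offset lam x < m)%N.
  exact: leq_ltn_trans (leq_subr _ _) (ltn_ord x).
pose col x := Ordinal (colm x).
rewrite -card_rows // -!sum1_card.
rewrite (partition_big col xpredT) //= [leqRHS](partition_big col xpredT) //=.
apply: leq_sum => c _; rewrite !sum1_card.
set X := (X in (#|X| <= _)%N); set Y := (Y in (_ <= #|Y|)%N).
have XS : (#|X| <= size S)%N.
  rewrite cardE -(size_map phi); apply: uniq_leq_size.
    rewrite map_inj_in_uniq ?enum_uniq // => x y; rewrite !mem_enum !unfold_in.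
    move=> /andP[_ /eqP xc] /andP[_ /eqP yc] phi_xy; apply: contra_eq phi_xy => xy.
    by apply: phi_col => //; have := congr1 val (etrans xc (esym yc)).
  move=> t /mapP [x]; rewrite mem_enum unfold_in inE => /andP[phix _] ->.
  exact: phix.
(* Either the column reaches below row size S - 1 and so meets each of the first size S rows, or it
   lies entirely within them. *)
have [/existsP [x /andP[/eqP xc xS]]|] :=
    boolP [exists x, (col x == c) && (size S <= reshape_index lam x)%N].
  apply: leq_trans XS _.
  have box (r : 'I_(size S)) : exists y, reshape_index lam y = r /\
      reshape_offset lam y = c.
    apply: box_exists => //.
    have cx : (c < nth 0 lam (reshape_index lam x))%N.
      by rewrite -xc /=; apply: reshape_offsetP; rewrite lm.
    apply: leq_trans cx _; have /and3P [sl _ _] := pl.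
    have xs : (reshape_index lam x < size lam)%N by apply: reshape_indexP; rewrite lm.
    have rx : (r <= reshape_index lam x)%N by apply: ltnW; apply: leq_trans xS.
    apply: (sorted_leq_nth _ _ 0 sl) => //.
    - by move=> a b d /= ab bd; apply: leq_trans ab.
    - by move=> a /=.
    - by rewrite inE; apply: leq_ltn_trans xs.
  pose f (r : 'I_(size S)) := sval (cid (box r)).
  have fP (r : 'I_(size S)) : reshape_index lam (f r) = r /\ reshape_offset lam (f r) = c.
    exact: svalP (cid (box r)).
  rewrite -[size S]card_ord -cardsT -(card_imset _ (_ : injective f)); last first.
    by move=> r s frs; apply: val_inj; rewrite /= -(fP r).1 -(fP s).1 frs.
  apply: subset_leq_card; apply/fintype.subsetP => _ /imsetP [r _ ->].
  rewrite unfold_in inE (fP r).1 ltn_ord /=; apply/eqP/val_inj.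
  by rewrite /= (fP r).2.
rewrite negb_exists => /forallP noS; apply: subset_leq_card.
apply/fintype.subsetP => x; rewrite !unfold_in => /andP[_ xc].
rewrite -[X in is_true (X && _)]/(x \in [set _ | _]) inE xc andbT; have := noS x;
  by rewrite xc /= -ltnNge.
Qed.

End Tableaux.

(** * Row and column symmetrizers, and orthogonality of distinct shapes *)

Section YoungSymmetrizers.
Variables (R : realType) (m : nat).
Local Notation C := (R[i]).
Local Notation G := {perm 'I_m}.
Local Notation ga := (ga R m).
Local Notation gdel := (gdel R).
Implicit Types (lam mu : seq nat) (x y : 'I_m) (p q s g : G) (z : ga).

Lemma row_stabP lam p : reflect
  (forall x, reshape_index lam (p x) = reshape_index lam x) (p \in row_stab m lam).
Proof. by rewrite inE; apply: (iffP forallP) => H x; apply/eqP; rewrite H. Qed.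

Lemma col_stabP lam p : reflect
  (forall x, reshape_offset lam (p x) = reshape_offset lam x) (p \in col_stab m lam).
Proof. by rewrite inE; apply: (iffP forallP) => H x; apply/eqP; rewrite H. Qed.

Lemma row_stab_group lam : group_set (row_stab m lam).
Proof.
apply/group_setP; split=> [|p q /row_stabP rp /row_stabP rq].
  by apply/row_stabP => x; rewrite perm1.
by apply/row_stabP => x; rewrite permM rq rp.
Qed.

Lemma col_stab_group lam : group_set (col_stab m lam).
Proof.
apply/group_setP; split=> [|p q /col_stabP rp /col_stabP rq].
  by apply/col_stabP => x; rewrite perm1.
by apply/col_stabP => x; rewrite permM rq rp.
Qed.

Canonical row_stab_subgroup lam := Group (row_stab_group lam).
Canonical col_stab_subgroup lam := Group (col_stab_group lam).

Definition row_sum lam : ga := \sum_(p in row_stab m lam) gdel p.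

Definition col_asum lam : ga :=
  \sum_(q in col_stab m lam) (-1 : C) ^+ odd_perm q *: gdel q.

Definition young lam : ga := young_symmetrizer R m lam.

Lemma young_mul lam : young lam = row_sum lam * col_asum lam.
Proof.
rewrite /row_sum mulr_suml; apply/ffunP => u; rewrite ffunE ga_sumE.
apply: eq_bigr => p _; rewrite mulr_sumr ga_sumE.
rewrite big_mkcondr; apply: eq_bigr => q _; rewrite -scalerAr -gdelM.
transitivity ((-1 : C) ^+ odd_perm q * gdel (p * q) u); last exact/esym/ga_scaleE.
by rewrite gdelE eq_sym; case: eqP; rewrite ?mulr1 ?mulr0.
Qed.

Lemma gdel_row_sum lam p : p \in row_stab m lam ->
  gdel p * row_sum lam = row_sum lam.
Proof.
move=> pR; rewrite mulr_sumr [RHS](reindex_inj (mulgI p)) /=.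
by apply: eq_big => q; rewrite ?gdelM // groupMl.
Qed.

Lemma row_sum_star lam : gstar (row_sum lam) = row_sum lam.
Proof.
apply/ffunP => s; rewrite ffunE !ga_sumE rmorph_sum /=.
rewrite (reindex_inj invg_inj) /=; apply: eq_big => p; first by rewrite groupV.
by move=> _; rewrite !gdelE rmorph_nat (can2_eq invgK invgK) invgK.
Qed.

Lemma col_asum_star lam : gstar (col_asum lam) = col_asum lam.
Proof.
apply/ffunP => s; rewrite ffunE !ga_sumE rmorph_sum /=.
rewrite (reindex_inj invg_inj) /=; apply: eq_big => p; first by rewrite groupV.
move=> _; transitivity (((-1 : C) ^+ odd_perm p^-1 * gdel p^-1 s^-1%g)^*).
  by congr (_^*); apply: ga_scaleE.
transitivity ((-1 : C) ^+ odd_perm p * gdel p s); last exact/esym/ga_scaleE.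
rewrite !gdelE rmorphM rmorphXn rmorphN1 rmorph_nat odd_permV.
by rewrite (can2_eq invgK invgK) invgK.
Qed.

Lemma col_asum_del lam q : q \in col_stab m lam ->
  col_asum lam * gdel q = (-1 : C) ^+ odd_perm q *: col_asum lam.
Proof.
move=> qC; rewrite mulr_suml scaler_sumr (reindex_inj (mulIg q^-1%g)) /=.
apply: eq_big => p; first by rewrite groupMr // groupV.
move=> _; rewrite -scalerAl -gdelM mulgKV scalerA; congr (_ *: _).
by rewrite odd_permM odd_permV signr_addb mulrC.
Qed.

(** The transposition is absorbed by [z] but changes the sign of the column antisymmetrizer, so the
    product equals its own negative. *)
Lemma col_asum_tperm lam x y z : x != y ->
  reshape_offset lam x = reshape_offset lam y ->
  gdel (tperm x y) * z = z -> col_asum lam * z = 0.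
Proof.
move=> xy cxy tz.
have tC : tperm x y \in col_stab m lam.
  by apply/col_stabP => u; case: tpermP => // ->.
have : col_asum lam * z = - (col_asum lam * z).
  by rewrite -{1}tz mulrA col_asum_del // odd_tperm xy expr1 scaleN1r mulNr.
move=> /eqP; rewrite -subr_eq0 opprK -mulr2n -scaler_nat scaler_eq0 pnatr_eq0.
by move=> /eqP.
Qed.

(** By linearity some [gdel g] in place of [z] gives a nonzero product. Labelling each box of [lam]
    by the row of [mu] to which [g] sends it then gives distinct labels in every column, as
    otherwise a transposition kills the product. *)
Lemma col_row_dominates lam mu z : is_partition m lam -> is_partition m mu ->
  col_asum lam * z * row_sum mu != 0 -> dominates lam mu.
Proof.
move=> pl pm; have [g gN0|all0] := pickP (fun g
  => col_asum lam * gdel g * row_sum mu != 0).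
  move=> _ i; rewrite -[leqLHS](card_rows i (partition_sum pm)).
  rewrite -(card_imset _ (@perm_inj _ g^-1%g)).
  have -> : [set g^-1%g x | x in [set x : 'I_m | (reshape_index mu x < i)%N]] =
      [set x | reshape_index mu (g x) \in iota 0 i].
    apply/setP => x; rewrite inE mem_iota /= add0n.
    apply/imsetP/idP => [[y]|xi]; first by rewrite inE => yi ->; rewrite permKV.
    by exists (g x); rewrite ?inE // permK.
  rewrite -[i in leqRHS](size_iota 0).
  apply: (col_distinct_dominates (phi := fun x => reshape_index mu (g x)))
    => // x y xy cxy.
  apply: contraNneq gN0 => rxy; rewrite -mulrA; apply/eqP.
  apply: (col_asum_tperm xy cxy); rewrite mulrA -gdelM.
  (* Moved past [g], the column transposition of [lam] becomes a row transposition of [mu], which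
     [row_sum] absorbs. *)
  have -> : (tperm x y * g = g * tperm (g x) (g y))%g.
    by rewrite -tpermJ conjgE !mulgA mulgV mul1g.
  rewrite gdelM -mulrA gdel_row_sum //; apply/row_stabP => u.
  by case: tpermP => // ->.
case/eqP; rewrite [z]ga_sum [col_asum lam * _]mulr_sumr mulr_suml big1 // => s _.
rewrite -scalerAr -scalerAl; have /negbFE /eqP -> := all0 s; exact: scaler0.
Qed.

(** A nonzero product contains a column-row product of [lam] with [mu] and, after applying [gstar],
    one of [mu] with [lam]; dominance then holds both ways. *)
Lemma young_orthogonal lam mu z : is_partition m lam -> is_partition m mu ->
  lam != mu -> young lam * z * young mu = 0.
Proof.
move=> pl pm; apply: contra_neq_eq; rewrite !young_mul => yN0.
apply: (dominates_anti pl pm).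
  apply: (col_row_dominates (z := z)) => //; apply: contra_neq yN0 => bza.
  by rewrite !mulrA -(mulrA (row_sum lam)) -(mulrA (row_sum lam)) bza mulr0 mul0r.
set w := col_asum lam * z * row_sum mu.
apply: (col_row_dominates (z := gstar w)) => //; apply: contra_neq yN0 => bza.
have starE z' : row_sum lam * z' * col_asum mu =
    gstar (col_asum mu * gstar z' * row_sum lam).
  by rewrite !gstarM gstarK col_asum_star row_sum_star mulrA.
have : row_sum lam * w * col_asum mu = 0 by rewrite starE bza gstar0.
by rewrite /w !mulrA.
Qed.

(** Row and column stabilizers meet trivially, so the coefficient at the identity is 1. *)
Lemma young_neq0 lam : young lam != 0.
Proof.
suff y1 : young lam 1%g = 1.
  by apply/eqP => y0; move: y1; rewrite y0 ga_0E => /eqP; rewrite eq_sym oner_eq0.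
rewrite ffunE (bigD1 1%g) /=; last exact: group1.
rewrite (bigD1 1%g) /=; last by rewrite mulg1 eqxx andbT; exact: group1.
rewrite odd_perm1 expr0 [X in _ + X + _]big1; last first.
  by move=> q; rewrite mul1g => /andP[/andP[_ /eqP ->]]; rewrite eqxx.
rewrite addr0 big1 ?addr0 // => p; case/andP => pR p1;
  rewrite big1 // => q /andP[qC /eqP pq].
case/eqP: p1; apply/permP => x; rewrite perm1; apply: (@box_inj m lam).
  by move/row_stabP: pR.
have /col_stabP : p \in col_stab m lam.
  by rewrite -(groupMr _ qC) pq group1.
by [].
Qed.

End YoungSymmetrizers.

(** * Cycle types and completeness of the Specht modules *)

Section CycleType.
Local Open Scope nat_scope.
Variable m : nat.
Implicit Types s r : {perm 'I_m}.

Definition cycle_of s (X : {set 'I_m}) : seq 'I_m :=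
  if [pick x in X] is Some x then traject s x #|X| else [::].

Definition cycles s : seq (seq 'I_m) :=
  sort (fun t u => size u <= size t) [seq cycle_of s X | X <- enum (porbits s)].

Lemma mem_cycles s t : t \in cycles s ->
  exists x, [/\ t = traject s x #|porbit s x|, 0 < size t & iter (size t) s x = x].
Proof.
rewrite mem_sort => /mapP [X]; rewrite mem_enum => /imsetP [x _ ->] ->.
rewrite /cycle_of; case: pickP => [y yx|/(_ x)]; last by rewrite porbit_id.
exists y; have /eqP -> : porbit s x == porbit s y by rewrite eq_sym eq_porbit_mem.
rewrite size_traject iter_porbit; split=> //.
by apply/card_gt0P; exists y; rewrite porbit_id.
Qed.

Lemma flatten_cycles s : perm_eq (flatten (cycles s)) (enum 'I_m).
Proof.
have szf : size (flatten (cycles s)) = m.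
  rewrite size_flatten /shape (perm_sumn (perm_map size (permEl (perm_sort _ _)))).
  rewrite -map_comp sumnE big_map big_enum /= -[RHS]card_ord -cardsT.
  rewrite -sum1_card [RHS](partition_big (porbit s) (mem (porbits s))) /=; last first.
    by move=> x _; apply: imset_f.
  apply: eq_bigr => X /imsetP [x _ ->]; rewrite sum1_card /cycle_of.
  case: pickP => [y _|/(_ x)]; last by rewrite porbit_id.
  rewrite /= size_traject; apply: eq_card => z; apply: esym.
by rewrite -eq_porbit_mem -topredE /= inE.
have sub : {subset enum 'I_m <= flatten (cycles s)}.
  move=> x _; apply/flattenP; exists (cycle_of s (porbit s x)).
    by rewrite mem_sort map_f // mem_enum; apply: imset_f.
  rewrite /cycle_of; case: pickP => [y yx|/(_ x)]; last by rewrite porbit_id.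
  have /eqP -> : porbit s x == porbit s y by rewrite eq_sym eq_porbit_mem.
  by rewrite -porbit_traject porbit_sym.
rewrite perm_sym uniq_perm ?enum_uniq //.
  by apply: (leq_size_uniq (enum_uniq 'I_m)) sub _; rewrite szf size_enum_ord.
move=> x; rewrite mem_enum; apply/esym/sub; exact: mem_enum.
Qed.

Definition cycle_type s : seq nat := shape (cycles s).

Lemma cycle_type_partition s : is_partition m (cycle_type s).
Proof.
apply/and3P; split.
- rewrite /cycle_type /shape sorted_map; apply: sort_sorted => t u; exact: leq_total.
- apply/negP => /mapP [t /mem_cycles [x [_ t0 _]] t0']; by rewrite -t0' in t0.
- by rewrite -size_flatten (perm_size (flatten_cycles s)) size_enum_ord.
Qed.

(** One step to the right in a row, cyclically. A permutation moves the entries of its concatenated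
    cycle list along these positions, which depend only on its cycle type; matching two such lists
    position by position therefore conjugates one permutation into the other. *)
Definition next_box (lam : seq nat) (i : nat) : nat :=
  let a := reshape_index lam i in let c := reshape_offset lam i in
  flatten_index lam a (if c.+1 < nth 0 lam a then c.+1 else 0).

Lemma next_box_lt lam i : i < sumn lam -> next_box lam i < sumn lam.
Proof.
move=> im; have cl := reshape_offsetP im; apply: flatten_indexP.
by case: ifP => // _; apply: leq_ltn_trans cl.
Qed.

Lemma nth_cycles_next s x0 i : i < m ->
  s (nth x0 (flatten (cycles s)) i) =
  nth x0 (flatten (cycles s)) (next_box (cycle_type s) i).
Proof.
move=> im; have sm := partition_sum (cycle_type_partition s).
have im' : i < sumn (cycle_type s) by rewrite sm.
rewrite !nth_flatten -!/(cycle_type s) /next_box.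
set a := reshape_index _ i; set c := reshape_offset _ i.
have cl : c < nth 0 (cycle_type s) a by apply: reshape_offsetP.
have al : a < size (cycles s).
  by rewrite -(size_map size); apply: reshape_indexP.
have szE : nth 0 (cycle_type s) a = size (nth [::] (cycles s) a).
  by rewrite (nth_map [::]).
have [x [tE t0 itx]] := mem_cycles (mem_nth [::] al).
have nthE d : d < size (nth [::] (cycles s) a) ->
    nth x0 (nth [::] (cycles s) a) d = iter d s x.
  move=> dl; rewrite (set_nth_default x) // tE nth_traject //.
  by rewrite tE size_traject in dl.
rewrite szE in cl *; case: ifP => cl1.
  by rewrite flatten_indexKl ?flatten_indexKr ?szE // !nthE.
rewrite flatten_indexKl ?flatten_indexKr ?szE // !nthE //.
suff cE : c.+1 = size (nth [::] (cycles s) a) by rewrite -iterS cE itx.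
by apply/eqP; rewrite eqn_leq cl leqNgt cl1.
Qed.

Lemma cycle_type_conj s r : cycle_type s = cycle_type r ->
  exists g, (r = g * s * g^-1)%g.
Proof.
move=> sr; case: (posnP m) => [m0|m_gt0].
  by exists 1%g; apply/permP => x; have := ltn_ord x; rewrite {2}m0.
pose x0 := Ordinal m_gt0.
pose F u := flatten (cycles u).
have szF u : size (F u) = m by rewrite (perm_size (flatten_cycles u)) size_enum_ord.
have memF u x : x \in F u by rewrite (perm_mem (flatten_cycles u)) mem_enum.
have uniqF u : uniq (F u) by rewrite (perm_uniq (flatten_cycles u)) enum_uniq.
have iF u x : index x (F u) < m by have := index_mem x (F u); rewrite memF szF.
pose g x := nth x0 (F r) (index x (F s)).
have g_inj : injective g.
  move=> x y /eqP; rewrite nth_uniq ?szF ?iF // => /eqP xy.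
  by rewrite -(nth_index x0 (memF s x)) xy nth_index.
have gs x : g (s x) = r (g x).
  rewrite -{1}(nth_index x0 (memF s x)) nth_cycles_next // /g.
  rewrite index_uniq ?szF //.
    by rewrite sr -nth_cycles_next.
  have sm := partition_sum (cycle_type_partition s).
  by have := @next_box_lt (cycle_type s) (index x (F s)); rewrite sm; apply.
  exact: uniqF.
exists (perm g_inj)^-1%g; apply/permP => y.
by rewrite invgK !permM -[in LHS](permKV (perm g_inj) y) !permE gs.
Qed.

End CycleType.

(** * The finite type of partitions of m *)

Section Partitions.
Local Open Scope nat_scope.
Variable m : nat.

(** A partition of m has at most m parts, each at most m, so it is a truncation of some m-tuple over
    ['I_m.+1]. *)
Definition partitions : seq (seq nat) :=
  [seq lam <- [seq take i [seq val c | c <- (t : m.-tuple 'I_m.+1)] |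
     i <- iota 0 m.+1, t <- enum {: m.-tuple 'I_m.+1}] | is_partition m lam].

Lemma partition_size lam : is_partition m lam -> size lam <= m.
Proof.
case/and3P => _ l0 /eqP <-; elim: lam l0 => //= c lam IH.
rewrite inE negb_or eq_sym -lt0n => /andP[c0 /IH sl].
by rewrite -add1n leq_add.
Qed.

Lemma partition_nth_le lam r : is_partition m lam -> nth 0 lam r <= m.
Proof.
case/and3P => _ _ /eqP <-; elim: lam r => [|c lam IH] [|r] //=.
  exact: leq_addr.
exact: leq_trans (IH r) (leq_addl _ _).
Qed.

Lemma mem_partitions lam : (lam \in partitions) = is_partition m lam.
Proof.
rewrite mem_filter andb_idr // => pl; have sl := partition_size pl.
have [t tE] : exists t : m.-tuple 'I_m.+1,
    forall i, i < m -> nth 0 [seq val c | c <- t] i = nth 0 lam i.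
  exists [tuple inord (nth 0 lam i) | i < m] => i im.
  rewrite (nth_map ord0) ?size_tuple // -(tnth_nth _ _ (Ordinal im)).
  by rewrite tnth_mktuple /= inordK // ltnS partition_nth_le.
apply/allpairsP; exists (size lam, t); split; rewrite ?mem_iota ?mem_enum //.
apply: (@eq_from_nth _ 0) => [|i il];
  first by rewrite size_takel // size_map size_tuple.
by rewrite nth_take // tE // (leq_trans il).
Qed.

Definition partn := seq_sub partitions.

Lemma partnP (lam : partn) : is_partition m (ssval lam).
Proof. by rewrite -mem_partitions; exact: ssvalP. Qed.

Definition to_partn lam (pl : is_partition m lam) : partn :=
  SeqSub (etrans (mem_partitions lam) pl).

End Partitions.

(** * Isotypic projections of tensor powers *)

Section TensorPower.
Variables (R : realType) (m d : nat).
Local Notation C := (R[i]).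
Local Notation G := {perm 'I_m}.
Local Notation ga := (ga R m).
Local Notation gdel := (gdel R).
Local Notation W := (word m d).
Implicit Types (lam mu : seq nat) (s r g h : G) (x y z : ga) (u v w : W)
  (t : tpower R m d).

Definition iso_idem lam : ga := two_sided_idem (young R m lam).

Lemma sum_iso_idem : \sum_(lam : partn m) iso_idem (ssval lam) = 1.
Proof.
apply: (sum_two_sided_idem (c := fun lam : partn m => young R m (ssval lam))
  (ty := fun s => to_partn (cycle_type_partition s))).
- by move=> lam; exact: young_neq0.
- move=> lam mu x lm; apply: young_orthogonal; rewrite ?partnP //.
- by move=> s r [] /cycle_type_conj.
Qed.

Definition wact s w : W := [ffun x => w (s x)].

Lemma wactM s r w : wact (s * r) w = wact s (wact r w).
Proof. by apply/ffunP => x; rewrite !ffunE permM. Qed.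

Lemma wact1 w : wact 1 w = w.
Proof. by apply/ffunP => x; rewrite ffunE perm1. Qed.

Lemma wactK s : cancel (wact s) (wact s^-1).
Proof. by move=> w; rewrite -wactM mulVg wact1. Qed.

Lemma wactVK s : cancel (wact s^-1) (wact s).
Proof. by move=> w; rewrite -wactM mulgV wact1. Qed.

(** Matrix, in the basis of words, of [x] acting on the tensor power; this is the form in which
    [tmap] takes its factors. *)
Definition rmx x u w : C := \sum_s x s * (wact s w == u)%:R.

Lemma rmx_del s u w : rmx (gdel s) u w = (wact s w == u)%:R.
Proof.
rewrite /rmx (bigD1 s) //= gdelE eqxx mul1r big1 ?addr0 // => r /negPf rs.
by rewrite gdelE rs mul0r.
Qed.

Lemma rmx1 u w : rmx 1 u w = (u == w)%:R.
Proof. by rewrite -gdel1 rmx_del wact1 eq_sym. Qed.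

Lemma rmx_lin (I : finType) (a : I -> C) (F : I -> ga) u w :
  rmx (\sum_i a i *: F i) u w = \sum_i a i * rmx (F i) u w.
Proof.
rewrite /rmx; under [RHS]eq_bigr => i _ do rewrite mulr_sumr.
rewrite [RHS]exchange_big /=; apply: eq_bigr => s _.
rewrite ga_sumE mulr_suml; apply: eq_bigr => i _.
by rewrite mulrA; congr (_ * _); exact: ga_scaleE.
Qed.

Lemma rmx_sum (I : finType) (F : I -> ga) u w :
  rmx (\sum_i F i) u w = \sum_i rmx (F i) u w.
Proof.
transitivity (rmx (\sum_i (1 : C) *: F i) u w).
  by congr (rmx _ u w); apply: eq_bigr => i _; rewrite scale1r.
by rewrite rmx_lin; apply: eq_bigr => i _; rewrite mul1r.
Qed.

Lemma rmx_scale (a : C) x u w : rmx (a *: x) u w = a * rmx x u w.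
Proof.
rewrite /rmx mulr_sumr; apply: eq_bigr => s _.
by rewrite mulrA; congr (_ * _); exact: ga_scaleE.
Qed.

Lemma rmx_mul_del x s u w : rmx (x * gdel s) u w = rmx x u (wact s w).
Proof.
rewrite /rmx (reindex_inj (mulIg s)) /=; apply: eq_bigr => r _.
by rewrite mul_gdelE mulgK wactM.
Qed.

Lemma rmxM x y u w : rmx (x * y) u w = \sum_v rmx x u v * rmx y v w.
Proof.
rewrite [y in LHS]ga_sum mulr_sumr rmx_sum.
under [RHS]eq_bigr => v _ do rewrite {2}/rmx mulr_sumr.
rewrite [RHS]exchange_big /=; apply: eq_bigr => s _.
rewrite -scalerAr rmx_scale rmx_mul_del (bigD1 (wact s w)) //= eqxx mulr1.
rewrite mulrC big1 ?addr0 // => v /negPf vs.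
by rewrite eq_sym vs !mulr0.
Qed.

Lemma rmx_star x u w : rmx (gstar x) u w = (rmx x w u)^*.
Proof.
rewrite /rmx rmorph_sum (reindex_inj invg_inj) /=; apply: eq_bigr => s _.
rewrite gstarE invgK rmorphM rmorph_nat; congr (_ * (_ : bool)%:R).
by rewrite (can2_eq (wactVK s) (wactK s)) eq_sym.
Qed.

Lemma iso_idem_herm lam u w : (rmx (iso_idem lam) w u)^* = rmx (iso_idem lam) u w.
Proof. by rewrite -rmx_star two_sided_idem_star. Qed.

Lemma iso_idem_rmx_idem lam u w :
  \sum_v rmx (iso_idem lam) u v * rmx (iso_idem lam) v w = rmx (iso_idem lam) u w.
Proof. by rewrite -rmxM two_sided_idem_idem. Qed.

(** Half of Schur-Weyl duality: used for tensor powers of a matrix, which are invariant under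
    simultaneous permutation. *)
Lemma rmx_commute x (B : W -> W -> C) u w :
  (forall s u w, B (wact s u) (wact s w) = B u w) ->
  \sum_v rmx x u v * B v w = \sum_v B u v * rmx x v w.
Proof.
move=> Bs; rewrite /rmx; under eq_bigr => v _ do rewrite mulr_suml.
under [RHS]eq_bigr => v _ do rewrite mulr_sumr.
rewrite exchange_big [RHS]exchange_big /=; apply: eq_bigr => s _.
rewrite (bigD1 (wact s^-1 u)) //= wactVK eqxx mulr1 big1 ?addr0; last first.
  move=> v /negPf vu; rewrite (can2_eq (wactK s) (wactVK s)) vu mulr0 mul0r //.
rewrite (bigD1 (wact s w)) //= eqxx mulr1 big1 ?addr0; last first.
  by move=> v /negPf vu; rewrite eq_sym vu !mulr0.
by rewrite mulrC -(Bs s) wactVK.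
Qed.

Definition gact x t : tpower R m d := \sum_s x s *: act_word s t.

Lemma gactE x t u : gact x t u = \sum_w rmx x u w * t w.
Proof.
rewrite sum_ffunE /rmx; under [RHS]eq_bigr => w _ do rewrite mulr_suml.
rewrite [RHS]exchange_big; apply: eq_bigr => s _; rewrite !ffunE -[_ *: _]/(_ * _).
rewrite (bigD1 (wact s^-1 u)) //= wactVK eqxx mulr1 big1 ?addr0 // => w /negPf wu.
by rewrite (can2_eq (wactK s) (wactVK s)) wu mulr0 mul0r.
Qed.

Lemma gact_is_linear x : linear (gact x).
Proof.
move=> a t t'; rewrite /gact scaler_sumr -big_split; apply: eq_bigr => s _ /=.
have -> : act_word s (a *: t + t') = a *: act_word s t + act_word s t'.
  by apply/ffunP => w; rewrite !ffunE.
by rewrite scalerDr !scalerA mulrC.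
Qed.
HB.instance Definition _ x :=
  GRing.isLinear.Build C (tpower R m d) (tpower R m d) _ (gact x) (gact_is_linear x).

(** For a fixed vector this orbit map commutes with the symmetric group, so it supplies the
    intertwiners that [isotypic] asks for. *)
Definition gactr t (x : galg R m) := gact x t.

Lemma gactr_is_linear t : linear (gactr t).
Proof.
move=> a x y; rewrite /gactr /gact scaler_sumr -big_split; apply: eq_bigr => s _.
by rewrite !ffunE scalerDl scalerA.
Qed.
HB.instance Definition _ t :=
  GRing.isLinear.Build C (galg R m) (tpower R m d) _ (gactr t) (gactr_is_linear t).

Lemma gactM x y t : gact (x * y) t = gact x (gact y t).
Proof.
apply/ffunP => u; rewrite !gactE.
under eq_bigr => w _ do rewrite rmxM mulr_suml.
rewrite exchange_big; apply: eq_bigr => v _; rewrite gactE mulr_sumr.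
by apply: eq_bigr => w _; rewrite mulrA.
Qed.

Lemma gact_del s t : gact (gdel s) t = act_word s t.
Proof.
rewrite /gact (bigD1 s) //= gdelE eqxx scale1r big1 ?addr0 // => r /negPf rs.
by rewrite gdelE rs scale0r.
Qed.

Lemma galg_actE s x : galg_act s x = gdel s * x.
Proof. by apply/ffunP => u; rewrite gdel_mulE ffunE. Qed.

Lemma spechtP lam x : specht lam x -> exists y, x = y * young R m lam.
Proof. by []. Qed.

Lemma intertwiner_gact lam (f : 'Hom(galg R m, tpower R m d)) z x :
  intertwiner lam f -> specht lam x -> f (z * x) = gact z (f x).
Proof.
move=> fi sx; rewrite {1}[z]ga_sum mulr_suml.
transitivity (f (\sum_s (z s *: galg_act s x : galg R m))).
  by congr (f _); apply: eq_bigr => s _; rewrite galg_actE -scalerAl.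
by rewrite linear_sum; apply: eq_bigr => s _; rewrite linearZ /= fi.
Qed.

Lemma iso_idem_specht lam mu x : is_partition m lam -> is_partition m mu ->
  specht mu x -> iso_idem lam * x = if lam == mu then x else 0.
Proof.
move=> pl pm /spechtP [y ->].
have yJ : y * young R m mu \in two_sided (young R m mu).
  by apply: two_sided_mull; apply: two_sided_gen.
case: eqP yJ => [->|/eqP lm] yJ; first exact: two_sided_idemK.
apply: two_sided_idem_orthogonal yJ => x'; exact: young_orthogonal.
Qed.

Lemma gact_isotypic lam mu t : is_partition m lam -> is_partition m mu ->
  isotypic mu t -> gact (iso_idem lam) t = if lam == mu then t else 0.
Proof.
move=> pl pm [r [f [x [fi sx ->]]]]; rewrite linear_sum.
have -> : (if lam == mu then \sum_i f i (x i) else 0) =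
    \sum_i (if lam == mu then f i (x i) else 0).
  by case: eqP => // _; rewrite big1.
apply: eq_bigr => i _ /=; rewrite -(intertwiner_gact _ (fi i)) //.
by rewrite (iso_idem_specht pl pm) //; case: eqP => // _; rewrite linear0.
Qed.

(** Expand the idempotent into translates g c h of the Young symmetrizer c: each is the orbit map of
    the vector h t, evaluated at the element g c of the Specht module. *)
Lemma iso_idem_isotypic lam t : isotypic lam (gact (iso_idem lam) t).
Proof.
have /two_sidedP [beta eE] := two_sided_idem_in (young R m lam).
pose gh (i : 'I_#|{: G * G}|) := enum_val i.
exists #|{: G * G}|, (fun i => linfun (gactr (act_word (gh i).2 t))),
  (fun i => beta (gh i).1 (gh i).2 *: (gdel (gh i).1 * young R m lam)).
split.
- move=> i s x _; rewrite !lfunE /= /gactr galg_actE gactM.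
  by rewrite -[RHS]gact_del.
- move=> i; exists (beta (gh i).1 (gh i).2 *: gdel (gh i).1).
  exact: (ga_scaleAl (beta (gh i).1 (gh i).2) (gdel (gh i).1) (young R m lam)).
rewrite /iso_idem {1}eE pair_big /= -[LHS]/(gactr t _).
rewrite (reindex (@enum_val _ {: G * G})) /=; last exact/onW_bij/enum_val_bij.
rewrite linear_sum; apply: eq_bigr => i _.
set b := beta _ _; set z := gdel (gh i).1 * young R m lam.
transitivity (gact ((b *: z) * gdel (gh i).2) t).
  congr (gact _ t); exact: (ga_scaleAl b z (gdel (gh i).2)).
by rewrite lfunE /= /gactr gactM gact_del.
Qed.

Lemma gact_sum_idem t : t = \sum_(lam : partn m) gact (iso_idem (ssval lam)) t.
Proof.
apply/ffunP => u; rewrite sum_ffunE.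
under eq_bigr => lam _ do rewrite gactE.
rewrite exchange_big /=;
  under eq_bigr => w _ do rewrite -mulr_suml -rmx_sum sum_iso_idem rmx1.
rewrite (bigD1 u) //= eqxx mul1r big1 ?addr0 // => w /negPf wu.
by rewrite eq_sym wu mul0r.
Qed.

Lemma isotypic_proj_gact lam (P : 'End(tpower R m d)) t : is_partition m lam ->
  isotypic_proj lam P -> P t = gact (iso_idem lam) t.
Proof.
move=> pl [Pid P0]; rewrite {1}[t]gact_sum_idem linear_sum.
have PE (mu : partn m) : P (gact (iso_idem (ssval mu)) t) =
    if mu == to_partn pl then gact (iso_idem lam) t else 0.
  case: eqP => [->|/eqP mul]; first by apply: Pid; apply: iso_idem_isotypic.
  apply: P0 (partnP mu) _ (iso_idem_isotypic _ _).
  by apply: contra_neq mul => mul; apply: val_inj.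
by rewrite (eq_bigr _ (fun (nu : partn m) _ => PE nu)) -big_mkcond big_pred1_eq.
Qed.

Lemma end_entry_gact (P : 'End(tpower R m d)) x :
  (forall t, P t = gact x t) -> end_entry P = rmx x.
Proof.
move=> Px; apply/funext => u; apply/funext => w; rewrite /end_entry Px gactE.
rewrite (bigD1 w) //= ffunE eqxx mulr1 big1 ?addr0 // => v /negPf vw.
by rewrite ffunE vw mulr0.
Qed.

Lemma iso_idem_proj lam : is_partition m lam ->
  isotypic_proj lam (linfun (gact (iso_idem lam)) : 'End(tpower R m d)).
Proof.
move=> pl; split=> [t it|mu t pm ml it];
  rewrite lfunE /= (gact_isotypic pl _ it) ?eqxx //.
by rewrite eq_sym (negPf ml).
Qed.

(** If no rearrangement of [w] has distinct letters in every column, each translate of the Young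
    symmetrizer meets two equal letters in a column and its antisymmetrizer kills the word.
    Otherwise [col_distinct_dominates] applies to the rearranged word. *)
Lemma iso_idem_dominates lam u w (S : seq 'I_d) : is_partition m lam ->
  rmx (iso_idem lam) u w != 0 ->
  (#|[set x : 'I_m | w x \in S]| <= \sum_(r < size S) nth 0%N lam r)%N.
Proof.
move=> pl; have [h /forallP hP|noh] := pickP (fun h : G
  => [forall x : 'I_m, forall y : 'I_m,
    (x != y) && (reshape_offset lam x == reshape_offset lam y) ==> (w (h x) != w (h y))]).
  move=> _; rewrite -(card_imset _ (@perm_inj _ h^-1%g)).
  have -> : [set h^-1%g x | x in [set x : 'I_m | w x \in S]] =
      [set x : 'I_m | w (h x) \in S].
    apply/setP => x; rewrite inE; apply/imsetP/idP => [[y]|xi].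
      by rewrite inE => yi ->; rewrite permKV.
    by exists (h x); rewrite ?inE // permK.
  apply: (@col_distinct_dominates _ _ _ (fun x : 'I_m => w (h x)) S pl).
  move=> x y xy cxy.
  by have /forallP /(_ y) := hP x; rewrite xy cxy eqxx.
case/eqP; have /two_sidedP [beta] := two_sided_idem_in (young R m lam).
rewrite /iso_idem => ->; rewrite rmx_sum big1 // => g _; rewrite rmx_lin big1 // => h _.
have /negbT := noh h; rewrite negb_forall => /existsP [x].
rewrite negb_forall => /existsP [y]; rewrite negb_imply negbK.
case/andP => /andP[xy /eqP cxy] /eqP wxy.
rewrite rmx_mul_del young_mul mulrA; set z := gdel g * _; set w' := wact h w.
have tw : wact (tperm x y) w' = w'.
  by apply/ffunP => a; rewrite !ffunE; case: tpermP => [->|->|//]; rewrite wxy.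
have tC : tperm x y \in col_stab m lam.
  by apply/col_stabP => a; case: tpermP => // ->.
have : rmx (z * col_asum R m lam) u w' = - rmx (z * col_asum R m lam) u w'.
  rewrite -{1}tw -rmx_mul_del -mulrA col_asum_del // odd_tperm xy expr1.
  by rewrite -scalerAr rmx_scale mulN1r.
move=> /eqP; rewrite -subr_eq0 opprK -mulr2n -mulr_natl mulf_eq0 pnatr_eq0.
by move=> /eqP ->; rewrite mulr0.
Qed.

End TensorPower.

(** * Entropy inequalities *)

Section EntropyInequalities.
Variable R : realType.

Lemma xlnx_tangent (a b : R) : 0 <= a -> 0 < b ->
  (ln b + 1) * (a - b) <= a * ln a - b * ln b.
Proof.
rewrite le_eqVlt => /predU1P[<- b0|a0 b0].
  rewrite mul0r !sub0r mulrN lerN2 mulrDl mul1r mulrC; lra.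
have : ln (b / a) <= b / a - 1.
  have := @le_ln1Dx R (b / a - 1); rewrite [1 + (_ - 1)]addrC subrK; apply.
  by rewrite ltrBDr addrC subrr divr_gt0.
rewrite lnM ?posrE ?invr_gt0 // lnV ?posrE // => le1.
have : a * (ln b - ln a) <= a * (b / a - 1) by rewrite ler_pM2l.
rewrite [leRHS]mulrBr mulr1 [a * (b / a)]mulrC divfK ?gt_eqF //; lra.
Qed.

Lemma xlnx_superadd (x y : R) : 0 <= x -> 0 <= y ->
  x * ln x + y * ln y <= (x + y) * ln (x + y).
Proof.
have half (u v : R) : 0 <= u -> 0 <= v -> u * ln u <= u * ln (u + v).
  rewrite le_eqVlt => /predU1P[<-|u0] v0; first by rewrite !mul0r.
  by rewrite ler_pM2l // ler_ln ?posrE ?ltr_wpDr // lerDl.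
by move=> x0 y0; rewrite mulrDl lerD // ?half // addrC half.
Qed.

Lemma xlnx_ge (z : R) : 0 <= z -> - (2 * Num.sqrt z) <= z * ln z.
Proof.
rewrite le_eqVlt => /predU1P[<-|z0]; first by rewrite sqrtr0 mul0r mulr0 oppr0.
have s0 : 0 < Num.sqrt z by rewrite sqrtr_gt0.
have zE : z = Num.sqrt z * Num.sqrt z by rewrite -expr2 sqr_sqrtr // ltW.
have : ln (Num.sqrt z)^-1 <= (Num.sqrt z)^-1.
  by apply/ltW/ln_sublinear; rewrite invr_gt0.
rewrite lnV ?posrE // => le1.
rewrite {2 3}zE lnM ?posrE // -mulr2n -[_ *+ 2]mulr_natl.
have : Num.sqrt z * Num.sqrt z * (- ln (Num.sqrt z)) <=
    Num.sqrt z * Num.sqrt z * (Num.sqrt z)^-1.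
  by rewrite ler_pM2l // mulr_gt0.
rewrite mulfK ?gt_eqF //; lra.
Qed.

(** One-sided, as needed to bound an entropy from below. For y < p superadditivity leaves only the
    term at p - y; for y >= p the tangent at y has slope at most 1. *)
Lemma xlnx_continuity (p y del : R) : 0 <= p <= 1 -> 0 <= y <= 1 ->
  `|y - p| <= del -> del <= 1 -> y * ln y <= p * ln p + 2 * Num.sqrt del.
Proof.
move=> /andP[p0 p1] /andP[y0 y1] yp d1.
have d0 : 0 <= del by apply: le_trans yp.
have ds : del <= Num.sqrt del.
  rewrite -{1}(sqr_sqrtr d0) expr2 ler_piMl ?sqrtr_ge0 //.
  by rewrite -sqrtr1 ler_wsqrtr.
have [py|yp'] := leP p y; last first.
  have h0 : 0 <= p - y by rewrite subr_ge0 ltW.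
  have := xlnx_superadd y0 h0; rewrite [y + (_ - _)]addrC subrK.
  have := xlnx_ge h0.
  have : Num.sqrt (p - y) <= Num.sqrt del.
    by rewrite ler_wsqrtr // (le_trans _ yp) // distrC ler_norm.
  lra.
move: y0; rewrite le_eqVlt => /predU1P[y0|y0].
  have p00 : p = 0 by apply/eqP; rewrite eq_le p0 -y0 in py *; rewrite py.
  by rewrite -y0 p00 !mul0r add0r mulr_ge0 // sqrtr_ge0.
have := xlnx_tangent p0 y0.
have : ln y * (y - p) <= 0 by rewrite mulr_le0_ge0 ?ln_le0 ?subr_ge0.
have : y - p <= del by apply: le_trans yp; exact: ler_norm.
lra.
Qed.

Lemma abel_sum_ge (c g : nat -> R) n :
  (forall i, (i < n)%N -> g i.+1 <= g i) ->
  (forall i, (i <= n)%N -> 0 <= \sum_(j < i) c j) ->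
  g n * \sum_(i < n.+1) c i <= \sum_(i < n.+1) c i * g i.
Proof.
elim: n => [|n IHn] gd cs; first by rewrite !big_ord1 mulrC.
rewrite big_ord_recr [leRHS]big_ord_recr /= mulrDr [_ * c _]mulrC lerD2r.
apply: le_trans (IHn _ _); last 2 first.
- by move=> i iln; apply: gd; apply: leqW.
- by move=> i iln; apply: cs; apply: leqW.
by rewrite ler_wpM2r ?gd ?cs.
Qed.

(** Karamata's inequality: take tangents at the [b i], whose slopes ln (b i) + 1 decrease, and sum
    by parts; the boundary term vanishes because the totals agree. *)
Lemma majorization_xlnx (a b : nat -> R) n :
  (forall i, (i < n)%N -> 0 <= a i) -> (forall i, (i < n)%N -> 0 < b i) ->
  (forall i, (i.+1 < n)%N -> b i.+1 <= b i) ->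
  (forall i, (i <= n)%N -> \sum_(j < i) b j <= \sum_(j < i) a j) ->
  \sum_(j < n) a j = \sum_(j < n) b j ->
  \sum_(i < n) b i * ln (b i) <= \sum_(i < n) a i * ln (a i).
Proof.
case: n => [|n] a0 b0 bd ab sab; first by rewrite !big_ord0.
rewrite -subr_ge0 -sumrB.
apply: (@le_trans _ _ (\sum_(i < n.+1) (a i - b i) * (ln (b i) + 1))); last first.
  by apply: ler_sum => i _; rewrite mulrC xlnx_tangent ?a0 ?b0.
have := @abel_sum_ge (fun i => a i - b i) (fun i => ln (b i) + 1) n.
rewrite {1}sumrB sab subrr mulr0; apply.
  move=> i iln; rewrite lerD2r ler_ln ?posrE ?b0 ?bd //.
  exact: ltnW.
by move=> i iln; rewrite sumrB subr_ge0 ab // leqW.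
Qed.

(** Square (1 - z/2) exp(z/2) <= 1. The remaining polynomial inequality needs 1 - 3z + z^2 >= 0,
    which z <= 1/4 ensures. *)
Lemma expR_quad (z : R) : z <= 4%:R^-1 -> expR z <= 1 + z + z ^+ 2.
Proof.
move=> z4; have half : (1 - z / 2) ^+ 2 * expR z <= 1.
  have e2 : expR z = expR (z / 2) ^+ 2.
    by rewrite expr2 -expRD -splitr.
  have : (1 - z / 2) * expR (z / 2) <= 1.
    rewrite -ler_pdivlMr ?expR_gt0 // mul1r -expRN.
    by have := expR_ge1Dx (- (z / 2)).
  rewrite e2 -exprMn => le1; apply: exprn_ile1 => //.
  by rewrite mulr_ge0 ?expR_ge0 //; lra.
have : 1 <= (1 - z / 2) ^+ 2 * (1 + z + z ^+ 2).
  have -> : (1 - z / 2) ^+ 2 * (1 + z + z ^+ 2) =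
    1 + z ^+ 2 / 4%:R * (1 - 3%:R * z + z ^+ 2) by field.
  rewrite lerDl mulr_ge0 ?divr_ge0 ?sqr_ge0 //.
  by have := sqr_ge0 z; lra.
have s0 : 0 < (1 - z / 2) ^+ 2 by rewrite exprn_gt0 //; lra.
by move=> ge1; rewrite -(ler_pM2l s0); apply: le_trans ge1.
Qed.

Lemma poly_lt_exp (k c : R) (D : nat) : 0 <= k -> 0 < c ->
  exists2 m : nat, (0 < m)%N & k * (m.+1)%:R ^+ D * expR (- (m%:R * c)) < 1.
Proof.
move=> k0 c0; pose e := c / D.+1%:R.
have e0 : 0 < e by rewrite divr_gt0.
(* exp(m c) >= (m e)^(D+1) has one power of m more than the polynomial. [B] is the size from which
   this power wins, with 2^D coming from m + 1 <= 2m. *)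
pose B := k * 2 ^+ D / e ^+ D.+1.
have B0 : 0 <= B by rewrite !mulr_ge0 ?invr_ge0 ?exprn_ge0 // ltW.
exists (Num.truncn B).+1 => //; set m := (Num.truncn B).+1.
have Bm : B < m%:R by apply: truncnS_gt.
have m0 : 0 < m%:R :> R by rewrite ltr0n.
rewrite expRN -[_^-1]mul1r mulrA mulr1 ltr_pdivrMr ?expR_gt0 // mul1r.
have -> : m%:R * c = (m%:R * e) *+ D.+1.
  by rewrite -[RHS]mulr_natr /e -!mulrA mulVf ?mulr1 // pnatr_eq0.
rewrite -[(m%:R * e) *+ _]mulr_natl expRM_natl.
apply: (@lt_le_trans _ _ ((m%:R * e) ^+ D.+1)); last first.
  have me0 : 0 <= m%:R * e by rewrite mulr_ge0 // ltW.
  rewrite lerXn2r ?nnegrE ?expR_ge0 //.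
  by apply: le_trans (expR_ge1Dx _); rewrite lerDr.
apply: (@le_lt_trans _ _ (k * (2 * m%:R) ^+ D)).
  rewrite ler_wpM2l // lerXn2r ?nnegrE ?mulr_ge0 // -natrM ler_nat.
  by rewrite mul2n -addnn -addn1 leq_add2l.
have lt1 : k * 2 ^+ D < m%:R * e ^+ D.+1 by rewrite -ltr_pdivrMr ?exprn_gt0.
have M0 : 0 < m%:R ^+ D :> R by rewrite exprn_gt0.
apply: (@le_lt_trans _ _ (k * 2 ^+ D * m%:R ^+ D)); first by rewrite exprMn mulrA.
apply: (@lt_le_trans _ _ (m%:R * e ^+ D.+1 * m%:R ^+ D)); first by rewrite ltr_pM2r.
by rewrite [(m%:R * e) ^+ _]exprMn [m%:R ^+ D.+1]exprS mulrAC.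
Qed.

Definition nats_entropy (T : finType) (p : T -> R) : R := - \sum_x p x * ln (p x).

Lemma ln2_gt0 : 0 < ln 2 :> R.
Proof. by rewrite ln_gt0 // ltr1n. Qed.

Lemma entropyE (T : finType) (p : T -> R) : entropy p = nats_entropy p / ln 2.
Proof.
rewrite /entropy /nats_entropy mulNr mulr_suml; congr (- _).
by apply: eq_bigr => x _; rewrite mulrA.
Qed.

Lemma prod_word_const (m : nat) (T : finType) (p : T -> R) (w : {ffun 'I_m -> T}) :
  \prod_x p (w x) = \prod_i p i ^+ #|[set x | w x == i]|.
Proof.
rewrite (partition_big (fun x => w x) xpredT) //=; apply: eq_bigr => i _.
rewrite -[RHS]prodr_const; apply: eq_big => x; first by rewrite inE.
by move=> /eqP ->.
Qed.

(* Each word of type [mu] has probability [exp (- m H(mu/m))] under the product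
   measure with weights [mu/m]. *)
Lemma card_type_words (m n : nat) (mu : 'I_n -> nat) : (0 < m)%N ->
  (\sum_i mu i = m)%N ->
  #|[set w : {ffun 'I_m -> 'I_n} |
      [forall i, #|[set x | w x == i]| == mu i]]|%:R <=
  expR (m%:R * nats_entropy (fun i => (mu i)%:R / m%:R)).
Proof.
move=> m0 mus; set T := [set w | _]; set p := fun i => (mu i)%:R / m%:R.
have mR : m%:R != 0 :> R by rewrite pnatr_eq0 -lt0n.
have qE w : w \in T -> \prod_x p (w x) = (expR (m%:R * nats_entropy p))^-1.
  rewrite inE => /forallP wT; rewrite prod_word_const -expRN /nats_entropy.
  rewrite mulrN opprK mulr_sumr expR_sum; apply: eq_bigr => i _.
  have /eqP -> := wT i; rewrite mulrA [m%:R * _]mulrC divfK // expRM_natl.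
  have [mui0|mui0] := posnP (mu i); first by rewrite mui0 !expr0.
  by rewrite lnK // posrE divr_gt0 // ltr0n.
have p0 i : 0 <= p i by rewrite divr_ge0.
rewrite -[leRHS]mul1r -ler_pdivrMr ?expR_gt0 //.
have -> : #|T|%:R / expR (m%:R * nats_entropy p) = \sum_(w in T) \prod_x p (w x).
  by rewrite (eq_bigr _ qE) sumr_const mulr_natl.
have sum1 : \sum_(w : {ffun 'I_m -> 'I_n}) \prod_x p (w x) = 1.
  rewrite -(bigA_distr_bigA (fun _ => p)) big1 // => _ _.
  by rewrite -mulr_suml -natr_sum mus divff.
rewrite -[leRHS]sum1 big_mkcond /=; apply: ler_sum => w _; case: ifP => // _.
by apply: prodr_ge0.
Qed.

Lemma sum_nth_take (lam : seq nat) n :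
  (\sum_(r < n) nth 0 lam r = sumn (take n lam))%N.
Proof.
elim: lam n => [|c lam IH] [|n] /=; rewrite ?big_ord0 //.
  by rewrite big1 // => r _; rewrite nth_nil.
by rewrite big_ord_recl /= IH.
Qed.

Lemma partition_entropy_le (m d : nat) (lam : seq nat) (mu : 'I_d -> nat) :
  (0 < m)%N -> is_partition m lam -> (\sum_x mu x = m)%N ->
  (forall S, uniq S -> (\sum_(x <- S) mu x <= \sum_(r < size S) nth 0 lam r)%N) ->
  part_entropy R m lam <= entropy (fun x => (mu x)%:R / m%:R : R).
Proof.
move=> m0 pl mus dom; rewrite /part_entropy !entropyE ler_pM2r ?invr_gt0 ?ln2_gt0 //.
rewrite /nats_entropy lerN2.
have mR : 0 < m%:R :> R by rewrite ltr0n.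
(* Only letters that occur are kept, in decreasing order of frequency: [majorization_xlnx] needs
   positive, decreasing [b]. *)
pose xs := sort (fun x y => (mu y <= mu x)%N) [seq x <- enum 'I_d | (0 < mu x)%N].
have uxs : uniq xs by rewrite sort_uniq filter_uniq // enum_uniq.
have xs0 x : x \in xs -> (0 < mu x)%N by rewrite mem_sort mem_filter => /andP[].
have sum_xs (V : nmodType) (F : 'I_d -> V) : (forall x, mu x = 0%N -> F x = 0) ->
    \sum_x F x = \sum_(x <- xs) F x.
  move=> F0; rewrite (perm_big _ (permEl (perm_sort _ _))) big_filter big_enum_cond /=.
  rewrite [LHS](bigID (fun x => (0 < mu x)%N)) /= [X in _ + X]big1 ?addr0 //.
  by move=> x; rewrite -eqn0Ngt => /eqP /F0.
set n := size xs.
have lam_sum k : (\sum_(r < k) nth 0 lam r <= m)%N.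
  rewrite sum_nth_take -[leqRHS](partition_sum pl) -{2}(cat_take_drop k lam) sumn_cat.
  exact: leq_addr.
have mxs : (\sum_(x <- xs) mu x = m)%N by rewrite -mus (sum_xs _ mu).
(* By dominance the first [n] rows already hold all m boxes, so [lam] has at most [n] parts and both
   sums can run over the same range. *)
have lam_n : (\sum_(r < n) nth 0 lam r = m)%N.
  by apply/eqP; rewrite eqn_leq lam_sum -{1}mxs dom.
have sl : (size lam <= n)%N.
  rewrite leqNgt; apply/negP => nl; have := lam_sum n.+1.
  rewrite big_ord_recr /= lam_n -[leqRHS]addn0 leq_add2l leqn0 => /eqP l0.
  by have := partition_nth_gt0 pl nl; rewrite l0.
pose a i : R := (nth 0%N lam i)%:R / m%:R.
pose b i : R := (nth 0%N (map mu xs) i)%:R / m%:R.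
have -> : \sum_x (mu x)%:R / m%:R * ln ((mu x)%:R / m%:R) = \sum_(i < n) b i * ln (b i).
  rewrite (sum_xs _ (fun x => (mu x)%:R / m%:R * ln ((mu x)%:R / m%:R) : R));
    last first.
    by move=> x ->; rewrite !mul0r.
  case E: xs => [|x0 xs']; first by rewrite /n E big_nil big_ord0.
  rewrite -E (big_nth x0) big_mkord; apply: eq_bigr => i _.
  by rewrite /b (nth_map x0).
have -> : \sum_(x < size lam) (nth 0%N lam x)%:R / m%:R * ln ((nth 0%N lam x)%:R / m%:R) =
    \sum_(i < n) a i * ln (a i).
  rewrite (big_ord_widen _ (fun i => a i * ln (a i)) sl) big_mkcond /=.
  apply: eq_bigr => i _; case: ltnP => // li.
  by rewrite /a nth_default // !mul0r.
have sum_b k : (k <= n)%N -> \sum_(j < k) b j = (\sum_(x <- take k xs) mu x)%:R / m%:R.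
  move=> kn; rewrite -mulr_suml -natr_sum; congr (_%:R / _).
  by rewrite sum_nth_take -map_take sumnE big_map.
apply: majorization_xlnx.
- by move=> i _; rewrite divr_ge0.
- move=> i il; rewrite divr_gt0 // ltr0n.
  have : nth 0%N (map mu xs) i \in map mu xs by rewrite mem_nth // size_map.
  by case/mapP => x /xs0 x0 ->.
- move=> i il; rewrite ler_pM2r ?invr_gt0 // ler_nat.
  have : sorted (fun u v => v <= u)%N (map mu xs).
    by rewrite sorted_map; apply: sort_sorted => x y; apply: leq_total.
  by move=> /(sortedP 0%N) /(_ i); rewrite size_map; apply.
- move=> i il; rewrite sum_b // -mulr_suml -natr_sum ler_pM2r ?invr_gt0 // ler_nat.
  by have := dom (take i xs) (take_uniq _ uxs); rewrite size_takel.
- by rewrite sum_b // take_size mxs -mulr_suml -natr_sum lam_n.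
Qed.

(* A second-order estimate of the Renyi entropies near the Shannon entropy. *)
Lemma sum_power_le (T : finType) (r : T -> R) (s : R) : is_dist r -> 0 <= s ->
  \sum_x r x * expR (s * ln (r x)) <=
  expR (- (s * nats_entropy r) + s ^+ 2 * \sum_x r x * ln (r x) ^+ 2).
Proof.
move=> [r0 r1] s0; apply: le_trans (expR_ge1Dx _).
have r_le1 x : r x <= 1 by rewrite -r1 (bigD1 x) //= lerDl sumr_ge0.
apply: (@le_trans _ _ (\sum_x r x * (1 + s * ln (r x) + (s * ln (r x)) ^+ 2))).
  apply: ler_sum => x _; rewrite ler_wpM2l // expR_quad //.
  by apply: (@le_trans _ _ 0); rewrite ?invr_ge0 // mulr_ge0_le0 // ln_le0.
rewrite /nats_entropy mulrN opprK !mulr_sumr -[X in _ <= X + _]r1 -!big_split /=.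
apply: ler_sum => x _; rewrite le_eqVlt; apply/orP; left; apply/eqP; ring.
Qed.

End EntropyInequalities.

(** * The upper quantum functional is at most the support functional *)

Section TensorMaps.
Variables (R : realType) (k : nat).
Local Notation C := (R[i]).

Lemma eq_midx (I : 'I_k -> finType) (a b : midx I) : (a == b) = [forall j, a j == b j].
Proof.
apply/eqP/forallP => [-> // |ab]; apply/ffunP => j; exact/eqP/ab.
Qed.

Lemma prod_delta (I : 'I_k -> finType) (a b : midx I) :
  \prod_j (a j == b j)%:R = (a == b)%:R :> C.
Proof.
rewrite eq_midx; case: forallP => [ab|nab].
  by rewrite big1 // => j _; rewrite ab.
have [/forallP //|] := boolP [forall j, a j == b j].
rewrite negb_forall; case/existsP => j /negPf abj.
by rewrite (bigD1 j) //= abj mul0r.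
Qed.

Lemma tmap_comp (I : 'I_k -> finType) (A B : forall j, I j -> I j -> C)
    (t : tens R I) :
  tmap A (tmap B t) = tmap (fun j x z => \sum_y A j x y * B j y z) t.
Proof.
apply/ffunP => a; rewrite !ffunE.
under eq_bigr => b _ do rewrite ffunE mulr_sumr.
rewrite exchange_big; apply: eq_bigr => c _ /=.
under eq_bigr => b _ do rewrite mulrA -big_split.
rewrite -mulr_suml; congr (_ * _).
by rewrite (bigA_distr_midx (fun j y => A j (a j) y * B j y (c j))).
Qed.

Lemma eq_tmap (I : 'I_k -> finType) (A B : forall j, I j -> I j -> C) (t : tens R I) :
  (forall j x y, A j x y = B j x y) -> tmap A t = tmap B t.
Proof.
move=> AB; apply/ffunP => a; rewrite !ffunE; apply: eq_bigr => b _.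
by congr (_ * _); apply: eq_bigr => j _; rewrite AB.
Qed.

Lemma tmap_id (I : 'I_k -> finType) (t : tens R I) :
  tmap (fun j x y => (x == y)%:R) t = t.
Proof.
apply/ffunP => a; rewrite ffunE (bigD1 a) //= prod_delta eqxx mul1r.
rewrite big1 ?addr0 // => b /negPf ba.
by rewrite prod_delta eq_sym ba mul0r.
Qed.

Lemma tmap0 (I : 'I_k -> finType) (A : forall j, I j -> I j -> C) :
  tmap A (0 : tens R I) = 0.
Proof. by apply/ffunP => a; rewrite !ffunE big1 // => b _; rewrite ffunE mulr0. Qed.

Definition mpow (m d : nat) (A : 'I_d -> 'I_d -> C) (u w : word m d) : C :=
  \prod_x A (u x) (w x).

Lemma mpow_act (m d : nat) (A : 'I_d -> 'I_d -> C) s (u w : word m d) :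
  mpow A (wact s u) (wact s w) = mpow A u w.
Proof.
rewrite /mpow [RHS](reindex_inj (@perm_inj _ s)) /=.
by apply: eq_bigr => x _; rewrite !ffunE.
Qed.

Variable n : 'I_k -> nat.
Local Notation idx := (midx (fun j => 'I_(n j) : finType)).

(** Reads a k-tuple of words of length m as m successive index k-tuples. *)
Definition letter (m : nat) (w : midx (fun j => word m (n j))) (x : 'I_m) : idx :=
  [ffun j => w j x].

Lemma tens_powE (m : nat) (t : tensor R n) w :
  tens_pow m t w = \prod_(x < m) t (letter w x).
Proof. by rewrite ffunE. Qed.

Lemma tens_pow_tmap (m : nat) (A : forall j, 'I_(n j) -> 'I_(n j) -> C)
    (t : tensor R n) :
  tens_pow m (tmap A t) = tmap (fun j => mpow (A j)) (tens_pow m t).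
Proof.
apply/ffunP => u; rewrite tens_powE ffunE.
under eq_bigr => x _ do rewrite ffunE.
rewrite (bigA_distr_bigA (fun x (b : idx)
  => (\prod_j A j (letter u x j) (b j)) * t b)) /=.
pose h (f : {ffun 'I_m -> idx}) : midx (fun j => word m (n j)) :=
  [ffun j => [ffun x => f x j]].
rewrite [RHS](reindex h) /=; last first.
  exists (fun w => [ffun x => letter w x]) => [f|w] _.
    by apply/ffunP => x; rewrite ffunE; apply/ffunP => j; rewrite !ffunE.
  by apply/ffunP => j; rewrite ffunE; apply/ffunP => x; rewrite !ffunE.
apply: eq_bigr => f _; rewrite big_split /= tens_powE; congr (_ * _).
  rewrite exchange_big; apply: eq_bigr => j _; apply: eq_bigr => x _.
  by rewrite !ffunE.
apply: eq_bigr => x _; congr (t _).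
by apply/ffunP => j; rewrite !ffunE.
Qed.

Lemma tcoefK (B : forall j, 'M[C]_(n j)) (t : tensor R n) : is_bases B ->
  tmap (fun j => B j) (tcoef B t) = t.
Proof.
move=> Bb; rewrite tmap_comp -[RHS]tmap_id; apply: eq_tmap => j x y.
by have := congr1 (fun M : 'M[C]_(n j) => M x y) (mulmxV (Bb j)); rewrite !mxE.
Qed.

Lemma card_letter (m : nat) (w : midx (fun j => word m (n j))) j y :
  (\sum_(a : idx | a j == y) #|[set x | letter w x == a]| =
   #|[set x | w j x == y]|)%N.
Proof.
rewrite -[RHS]sum1_card (partition_big (letter w) (fun a => a j == y)) /=.
  apply: eq_bigr => a /eqP aj; rewrite -sum1_card; apply: eq_bigl => x.
  rewrite !inE; apply/idP/andP => [/eqP xa|[]//].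
  by rewrite -aj -xa ffunE eqxx.
by move=> x; rewrite inE ffunE.
Qed.

Lemma upper_quantum_le_support (theta : 'I_k -> R) (t : tensor R n)
    (B : forall j, 'M[C]_(n j)) :
  (forall j, 0 <= theta j) -> is_bases B ->
  (upper_quantum theta t <= max_entropy theta (tsupp B t))%E.
Proof.
move=> theta0 Bb; apply: ge_ereal_sup => _ [m [lam [P [m0 pl iP tN0 ->]]]].
have PE j : end_entry (P j) = rmx (iso_idem R m (lam j)).
  by apply: end_entry_gact => v; apply: isotypic_proj_gact.
(* The projections commute with the m-th tensor power of the change of basis, so the nonvanishing
   can be tested on coordinates with respect to [B]. *)
have [w [wE wt]] : exists w : midx (fun j => word m (n j)),
    (exists u : midx (fun j => word m (n j)),
       forall j, rmx (iso_idem R m (lam j)) (u j) (w j) != 0) /\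
    tens_pow m (tcoef B t) w != 0.
  apply: contrapT => no; case/eqP: tN0.
  rewrite -(tcoefK t Bb) tens_pow_tmap tmap_comp.
  rewrite (eq_tmap (B := fun j x z => \sum_y mpow (B j) x y * end_entry (P j) y z));
    last first.
    by move=> j x z; rewrite PE; apply: rmx_commute => s v v'; apply: mpow_act.
  rewrite -tmap_comp; set z := tmap _ (tens_pow _ _).
  suff -> : z = 0 by rewrite tmap0.
  apply/ffunP => u; rewrite !ffunE big1 // => w _; apply/eqP.
  rewrite mulf_eq0; apply/negPn/negP; rewrite negb_or => /andP[pN0 tw]; apply: no.
  exists w; split=> //; exists u => j; rewrite -PE.
  by apply: contra_neq pN0 => uw0; rewrite (bigD1 j) //= uw0 mul0r.
have mR : m%:R != 0 :> R by rewrite pnatr_eq0 -lt0n.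
(* The empirical distribution of the letters of [w]. The coefficient at [w] is the product of the
   coefficients at its letters, so all of them lie in the support. *)
pose Q (a : idx) : R := #|[set x | letter w x == a]|%:R / m%:R.
have marg j y : marginal Q (j := j) y = #|[set x | w j x == y]|%:R / m%:R.
  by rewrite /marginal -mulr_suml -natr_sum card_letter.
have Qd : dist_on (tsupp B t) Q.
  split; first split.
  - by move=> a; rewrite divr_ge0.
  - rewrite -mulr_suml -natr_sum.
    suff -> : (\sum_a #|[set x | letter w x == a]| = m)%N by rewrite divff.
    rewrite -[RHS]card_ord -sum1_card (partition_big (letter w) xpredT) //=.
    by apply: eq_bigr => a _; rewrite -sum1_card; apply: eq_bigl => x; rewrite inE.
  move=> a; rewrite inE negbK => /eqP ta; rewrite /Q (_ : #|_| = 0%N) ?mul0r //.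
  apply: eq_card0 => x; rewrite inE; apply/negP => /eqP xa.
  by case/eqP: wt; rewrite tens_powE (bigD1 x) //= xa ta mul0r.
apply: (@le_trans _ _ (\sum_j theta j * entropy (marginal Q (j := j)))%:E); last first.
  by apply: ereal_sup_ubound; exists Q.
rewrite lee_fin; apply: ler_sum => j _; rewrite ler_wpM2l //.
have -> : entropy (marginal Q (j := j)) =
    entropy (fun y => #|[set x | w j x == y]|%:R / m%:R : R).
  by congr entropy; apply/funext => y; rewrite marg.
apply: partition_entropy_le => //.
  rewrite -[RHS]card_ord -sum1_card (partition_big (fun x => w j x) xpredT) //=.
  by apply: eq_bigr => y _; rewrite -sum1_card; apply: eq_bigl => x; rewrite inE.
move=> S uS; have [u uw] := wE.
apply: leq_trans (iso_idem_dominates S (pl j) (uw j)).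
have -> : (\sum_(y <- S) #|[set x | w j x == y]| =
    \sum_x \sum_(y <- S) (w j x == y))%N.
  rewrite exchange_big; apply: eq_bigr => y _ /=; rewrite -sum1_card big_mkcond.
  by apply: eq_bigr => x _; rewrite inE; case: eqP.
rewrite -sum1_card [leqRHS]big_mkcond; apply: leq_sum => x _; rewrite inE.
rewrite -big_mkcond sum1_count (eq_count (a2 := pred1 (w j x))).
  by rewrite count_uniq_mem //; case: (_ \in _).
by move=> y; rewrite /= eq_sym.
Qed.

End TensorMaps.

(** * The support functional of a free tensor is at most the lower quantum functional *)

Section SpectralEntropy.
Variable R : realType.
Local Notation C := (R[i]).
Local Notation rc := (real_complex R).

Lemma char_poly_conj (d : nat) (P A : 'M[C]_d) : P \in unitmx ->
  char_poly (invmx P *m A *m P) = char_poly A.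
Proof.
move=> Pu; rewrite /char_poly.
have -> : char_poly_mx (invmx P *m A *m P) =
    map_mx polyC (invmx P) *m char_poly_mx A *m map_mx polyC P.
  rewrite /char_poly_mx mulmxBr mulmxBl !map_mxM; congr (_ - _).
  by rewrite scalar_mxC -mulmxA -map_mxM mulVmx // map_mx1 mulmx1.
rewrite !det_mulmx mulrAC -det_mulmx -map_mxM mulVmx // map_mx1 det1.
by rewrite mul1r.
Qed.

(** The spectral theorem may list the eigenvalues in another order; comparing characteristic
    polynomials identifies the two lists up to a permutation. *)
Lemma vn_entropy_diag (d : nat) (q : 'I_d -> R) :
  vn_entropy (diag_mx (\row_x rc (q x))) = entropy q.
Proof.
set A := diag_mx _.
have /orthomx_spectralP AE : A \is normalmx.
  by apply/normalmxP; rewrite tr_diag_mx map_diag_mx diag_mxC.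
have chA : char_poly A = char_poly (diag_mx (spectral_diag A)).
  by rewrite {1}AE char_poly_conj // spectral_unit.
rewrite !char_poly_trig ?diag_mx_is_trig // in chA.
have chE (v : 'rV[C]_d) : \prod_i ('X - (diag_mx v i i)%:P) =
    \prod_(z <- [seq v 0 i | i <- enum 'I_d]) ('X - z%:P).
  by rewrite big_map big_enum; apply: eq_bigr => i _; rewrite mxE eqxx mulr1n.
rewrite !chE in chA; have /perm_map := prod_XsubC_eq chA.
move=> /(_ _ (fun z : C => complex.Re z * (ln (complex.Re z) / ln 2))).
rewrite /vn_entropy /entropy => pm; congr (- _).
have sumE (v : 'rV[C]_d) : \sum_i complex.Re (v 0 i) * (ln (complex.Re (v 0 i)) / ln 2) =
    \sum_(z <- [seq complex.Re z * (ln (complex.Re z) / ln 2)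
       | z <- [seq v 0 i | i <- enum 'I_d]]) z.
  by rewrite big_map big_map big_enum.
rewrite sumE -(perm_big _ pm) /= -sumE.
by apply: eq_bigr => i _; rewrite mxE.
Qed.

End SpectralEntropy.

(** * Exponential families with nearly prescribed marginals *)

Section ExponentialFamily.
Variables (R : realType) (T S : finType) (inc : S -> pred T) (c P : T -> R).
Hypotheses (c0 : forall a, 0 <= c a) (Pd : is_dist P)
  (Pc : forall a, c a = 0 -> P a = 0).
Implicit Types (u : S -> R) (a : T) (o : S).

Definition score u a := \sum_(o | inc o a) u o.
Definition partition_fun u := \sum_a c a * expR (score u a).
Definition family_marg u o :=
  (\sum_(a | inc o a) c a * expR (score u a)) / partition_fun u.
Definition dist_marg o := \sum_(a | inc o a) P a.
(** Its derivative in direction [o] is [family_marg u o - dist_marg o]. The infimum need not be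
    attained when [P] vanishes on part of the support of [c]. *)
Definition log_objective u := ln (partition_fun u) - \sum_o u o * dist_marg o.

Lemma dist_pos_exists : exists a, 0 < c a.
Proof.
have [P0 P1] := Pd; apply: contrapT => no; move/eqP: P1;
  rewrite eq_sym big1 ?oner_eq0 // => a _.
apply: Pc; apply/eqP; rewrite eq_le c0 andbT leNgt; apply/negP => ca; apply: no.
by exists a.
Qed.

Lemma partition_fun_gt0 u : 0 < partition_fun u.
Proof.
have [a ca] := dist_pos_exists; rewrite /partition_fun (bigD1 a) //=.
rewrite ltr_pwDl ?mulr_gt0 ?expR_gt0 // sumr_ge0 // => b _.
by rewrite mulr_ge0 ?expR_ge0.
Qed.

Lemma sum_dist_marg u : \sum_o u o * dist_marg o = \sum_a P a * score u a.
Proof.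
under eq_bigr => o _ do rewrite /dist_marg mulr_sumr big_mkcond.
rewrite exchange_big; apply: eq_bigr => a _ /=.
by rewrite /score mulr_sumr -big_mkcond; apply: eq_bigr => o _; rewrite mulrC.
Qed.

(** The partition function is at least each of its terms; take logarithms and average over [P]. *)
Lemma log_objective_ge u : \sum_a P a * ln (c a) <= log_objective u.
Proof.
have [P0 P1] := Pd; rewrite /log_objective lerBrDr sum_dist_marg -big_split /=.
rewrite -[leRHS]mul1r -P1 mulr_suml; apply: ler_sum => a _; rewrite -mulrDr.
have [->|Pa] := eqVneq (P a) 0; first by rewrite !mul0r.
have ca : 0 < c a by rewrite lt_def c0 andbT; apply: contra_neq Pa; exact: Pc.
rewrite ler_wpM2l // -[score u a]expRK -lnM ?posrE ?expR_gt0 //.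
rewrite ler_ln ?posrE ?mulr_gt0 ?expR_gt0 ?partition_fun_gt0 //.
rewrite /partition_fun (bigD1 a) //= lerDl sumr_ge0 // => b _.
by rewrite mulr_ge0 ?expR_ge0.
Qed.

Definition shift u o (s : R) := fun o' => u o' + (o' == o)%:R * s.

Lemma score_shift u o s a : score (shift u o s) a = score u a + (inc o a)%:R * s.
Proof.
rewrite /score big_split /=; congr (_ + _).
rewrite -mulr_suml; congr (_ * _); case: (boolP (inc o a)) => oa.
  rewrite (bigD1 o) //= eqxx big1 ?addr0 // => o' /andP[_ /negPf ->] //.
rewrite big1 // => o' inc_o'; rewrite (_ : (o' == o) = false) //.
by apply: contraNF oa => /eqP <-.
Qed.

Lemma partition_fun_shift u o s :
  partition_fun (shift u o s) = partition_fun u * (1 + family_marg u o * (expR s - 1)).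
Proof.
rewrite mulrDr mulr1 /family_marg mulrA [partition_fun u * _]mulrC divfK; last first.
  by rewrite gt_eqF // partition_fun_gt0.
rewrite /partition_fun big_mkcond mulr_suml [X in _ + X]big_mkcond -big_split /=.
apply: eq_bigr => a _; rewrite score_shift expRD; case: (inc o a).
  by rewrite mul1r; ring.
by rewrite mul0r expR0 mulr1 addr0.
Qed.

Lemma family_marg_ge0 u o : 0 <= family_marg u o.
Proof.
rewrite /family_marg divr_ge0 ?(ltW (partition_fun_gt0 _)) // sumr_ge0 // => a _.
by rewrite mulr_ge0 ?expR_ge0.
Qed.

Lemma family_marg_le1 u o : family_marg u o <= 1.
Proof.
rewrite ler_pdivrMr ?partition_fun_gt0 // mul1r /partition_fun.
rewrite [leRHS](bigID (inc o)) /= lerDl sumr_ge0 // => a _.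
by rewrite mulr_ge0 ?expR_ge0.
Qed.

(* At a near-minimiser of the log-objective its directional derivatives, which are
   the differences of the marginals, are small. *)
Lemma family_marg_approx (del : R) : 0 < del -> del <= 4%:R^-1 ->
  exists u, forall o, `|family_marg u o - dist_marg o| <= 2 * del.
Proof.
move=> d0 d4; pose E := (range log_objective)%classic.
have Einf : has_inf E.
  split; first by exists (log_objective (fun _ => 0)); exists (fun _ => 0).
  by exists (\sum_a P a * ln (c a)) => _ [u _ <-]; exact: log_objective_ge.
have d20 : 0 < del ^+ 2 by rewrite exprn_gt0.
have [_ [u _ <-] uE] := inf_adherent d20 Einf.
exists u => o; set q := family_marg u o; set p := dist_marg o.
have q0 : 0 <= q by exact: family_marg_ge0.
have q1 : q <= 1 by exact: family_marg_le1.
(* Moving coordinate [o] by [s] cannot lead below the infimum, yet changes the objective by at most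
   s (q - p) + s^2. *)
have key s : s <= 4%:R^-1 -> - del ^+ 2 <= s * (q - p) + s ^+ 2.
  move=> s4.
  have le_inf : inf E <= log_objective (shift u o s).
    by apply: ge_inf; [have [] := Einf | exists (shift u o s)].
  have pos : 0 < 1 + q * (expR s - 1).
    have := partition_fun_gt0 (shift u o s); rewrite partition_fun_shift.
    by rewrite pmulr_rgt0 // partition_fun_gt0.
  have objE : log_objective (shift u o s) =
      log_objective u + ln (1 + q * (expR s - 1)) - s * p.
    rewrite /log_objective partition_fun_shift lnM ?posrE ?partition_fun_gt0 //.
    have -> : \sum_o' shift u o s o' * dist_marg o' =
        \sum_o' u o' * dist_marg o' + s * p.
      rewrite /shift; under eq_bigr => o' _ do rewrite mulrDl.
      rewrite big_split /=; congr (_ + _); rewrite (bigD1 o) //= eqxx mul1r.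
      by rewrite big1 ?addr0 // => o' /negPf ->; rewrite !mul0r.
    ring.
  have lnle : ln (1 + q * (expR s - 1)) <= q * (s + s ^+ 2).
    apply: (@le_trans _ _ (q * (expR s - 1))); first by apply: le_ln1Dx; lra.
    by rewrite ler_wpM2l //; have := expR_quad s4; lra.
  have : q * s ^+ 2 <= s ^+ 2 by rewrite ler_piMl // sqr_ge0.
  nra.
(* With s = del and s = -del this gives del |q - p| <= 2 del^2. *)
have k1 := key del d4; have k2 := key (- del) ltac:(lra).
rewrite ler_norml; apply/andP; split; nra.
Qed.

End ExponentialFamily.

(** * Free supports and diagonal rescaling *)

Section FreeSupport.
Variables (R : realType) (k : nat) (n : 'I_k -> nat).
Local Notation C := (R[i]).
Local Notation rc := (real_complex R).
Local Notation idx := (midx (fun j => 'I_(n j) : finType)).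
Local Notation cell := {j : 'I_k & 'I_(n j)}.
Implicit Types (t psi : tensor R n).

Definition sqmod (z : C) : R := complex.Re (z * z^*).

Lemma rc_inj : injective rc.
Proof. by move=> x y []. Qed.

Lemma rcM (x y : R) : rc (x * y) = rc x * rc y.
Proof. exact: (rmorphM rc). Qed.

Lemma rcV (x : R) : rc x^-1 = (rc x)^-1.
Proof. exact: (fmorphV rc). Qed.

Lemma rc_sum (I : finType) (P : pred I) (F : I -> R) :
  rc (\sum_(i | P i) F i) = \sum_(i | P i) rc (F i).
Proof. exact: (rmorph_sum rc). Qed.

Lemma rc_prod (I : finType) (P : pred I) (F : I -> R) :
  rc (\prod_(i | P i) F i) = \prod_(i | P i) rc (F i).
Proof. exact: (rmorph_prod rc). Qed.

Lemma rc_eq0 (x : R) : (rc x == 0) = (x == 0).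
Proof. exact: (fmorph_eq0 rc). Qed.

Lemma sqmodE (z : C) : z * z^* = rc (sqmod z).
Proof.
by rewrite /sqmod; apply/esym/RRe_real; apply: ger0_real; exact: mul_conjC_ge0.
Qed.

Lemma sqmod_ge0 (z : C) : 0 <= sqmod z.
Proof. by rewrite -ler0c -sqmodE mul_conjC_ge0. Qed.

Lemma sqmod_eq0 (z : C) : (sqmod z == 0) = (z == 0).
Proof. by rewrite -mul_conjC_eq0 sqmodE rc_eq0. Qed.

Lemma sqmodM (z w : C) : sqmod (z * w) = sqmod z * sqmod w.
Proof.
by apply: rc_inj; rewrite rcM -!sqmodE rmorphM mulrACA.
Qed.

Lemma sqmod_rc (x : R) : sqmod (rc x) = x ^+ 2.
Proof.
apply: rc_inj; rewrite -sqmodE expr2 rcM; congr (_ * _).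
exact: conjc_real.
Qed.

Definition cell_of (a : idx) (o : cell) : bool := a (tag o) == tagged o.

(** With pairs (coordinate, value) as cells, the exponential weight is a product over the
    coordinates, hence realised by diagonal matrices. *)
Lemma score_cells (u : cell -> R) (a : idx) :
  score (fun o a => cell_of a o) u a = \sum_j u (Tagged (fun j => 'I_(n j)) (a j)).
Proof.
rewrite /score; under [LHS]eq_bigl => o do rewrite /cell_of.
rewrite (reindex (fun j => Tagged (fun j => 'I_(n j)) (a j))) /=; last first.
  by exists tag => [j|[j x]] //=; rewrite unfold_in /= => /eqP ->.
by apply: eq_bigl => j; rewrite eqxx.
Qed.

Definition diag_tensor (u : forall j, 'I_(n j) -> R) t : tensor R n :=
  [ffun a : idx => rc (\prod_j u j (a j)) * t a].

Lemma diag_tensorE (u : forall j, 'I_(n j) -> R) t :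
  tmap (fun j x y => diag_mx (\row_z rc (u j z)) x y) t = diag_tensor u t.
Proof.
apply/ffunP => a; rewrite !ffunE (bigD1 a) //= [X in _ + X]big1 ?addr0.
  congr (_ * _); rewrite rc_prod; apply: eq_bigr => j _.
  by rewrite !mxE eqxx mulr1n.
move=> b; rewrite eq_midx negb_forall => /existsP [j /negPf ba].
by rewrite (bigD1 j) //= !mxE eq_sym ba mulr0n !mul0r.
Qed.

(** Two support points contributing to an off-diagonal entry would differ in coordinate j alone,
    which freeness forbids. *)
Lemma reduced_density_free psi (Phi : {set idx}) j : free_set Phi ->
  (forall a, psi a != 0 -> a \in Phi) ->
  reduced_density psi j = diag_mx (\row_x rc
    ((\sum_(a : idx | a j == x) sqmod (psi a)) / \sum_a sqmod (psi a))).
Proof.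
move=> Pf psiP; apply/matrixP => x y; rewrite !mxE.
have agree (a b : idx) : [forall l, (l != j) ==> (a l == b l)] -> a j = b j -> a = b.
  move=> /forallP ab abj; apply/ffunP => l; have [->//|lj] := eqVneq l j.
  by have := ab l; rewrite lj => /eqP.
have sumE : \sum_(c : idx) psi c * (psi c)^* = rc (\sum_c sqmod (psi c)).
  by rewrite rc_sum; apply: eq_bigr => c _; rewrite -sqmodE.
have [xy|xy] := eqVneq x y; last first.
  rewrite mulr0n big1 // => a /eqP ax; rewrite big1 // => b /andP[/eqP bY ab].
  rewrite /density; have [->|pa] := eqVneq (psi a) 0; first by rewrite !mul0r.
  have [->|pb] := eqVneq (psi b) 0; first by rewrite rmorph0 mulr0 mul0r.
  have ab' : a != b by apply: contra_neq xy => eab; rewrite -ax -bY eab.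
  have := Pf _ _ (psiP _ pa) (psiP _ pb) ab'.
  have /subset_leq_card : [pred l | a l != b l] \subset pred1 j.
    apply/fintype.subsetP => l; rewrite !inE; apply: contraR => lj.
    by have /forallP /(_ l) := ab; rewrite lj.
  by rewrite card1 => le1 /leq_trans /(_ le1).
rewrite mulr1n -xy rcM rcV -sumE rc_sum mulr_suml.
apply: eq_bigr => a /eqP ax; rewrite (big_pred1 a) /density ?sqmodE //.
move=> b; rewrite /= ; apply/andP/eqP => [[/eqP bx ab]|->].
  by apply/esym/agree => //; rewrite ax.
by rewrite ax; split=> //; apply/forallP => l; rewrite eqxx implybT.
Qed.

Lemma max_entropy_le_lower (theta : 'I_k -> R) t (B : forall j, 'M[C]_(n j)) :
  (forall j, 0 <= theta j) -> is_bases B -> free_set (tsupp B t) ->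
  (max_entropy theta (tsupp B t) <= lower_quantum theta t)%E.
Proof.
move=> theta0 Bb Bf; apply: ge_ereal_sup => _ [P [Pd PS] <-].
apply/lee_addgt0Pr => eps eps0.
(* Factor j loses at most n_j * 2 * sqrt(2 del) / ln 2 of entropy. [K] collects these constants with
   weights [theta], and the + 1 in [eta] keeps its denominator positive. *)
pose K := (\sum_j theta j * (n j)%:R) * 2 / ln 2.
have l2 := ln2_gt0 R.
have K0 : 0 <= K.
  rewrite /K !mulr_ge0 ?invr_ge0 ?(ltW l2) // sumr_ge0 // => j _.
  by rewrite mulr_ge0.
pose eta := eps / (K + 1).
have eta0 : 0 < eta by rewrite divr_gt0 // ltr_wpDl.
pose del := Num.min (4%:R^-1) (eta ^+ 2 / 2).
have del0 : 0 < del by rewrite lt_min invr_gt0 ltr0n divr_gt0 ?exprn_gt0.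
have del4 : del <= 4%:R^-1 by rewrite ge_min lexx.
have dele : Num.sqrt (2 * del) <= eta.
  rewrite -[leRHS]ger0_norm ?(ltW eta0) // -sqrtr_sqr ler_wsqrtr //.
  have : del <= eta ^+ 2 / 2 by rewrite ge_min lexx orbT.
  lra.
pose tB := tcoef B t.
pose c (a : idx) := sqmod (tB a).
have c0 a : 0 <= c a by exact: sqmod_ge0.
have Pc a : c a = 0 -> P a = 0.
  move=> /eqP; rewrite sqmod_eq0 => ta; apply: PS; by rewrite inE negbK.
have [u uP] := family_marg_approx (fun o a => cell_of a o) c0 Pd Pc del0 del4.
(* Half the exponent, because it is the squared moduli that have to follow the exponential
   family. *)
pose w j (x : 'I_(n j)) := expR (u (Tagged (fun j => 'I_(n j)) x) / 2).
pose D j : 'M[C]_(n j) := diag_mx (\row_x rc (w j x)).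
have Du j : D j \in unitmx.
  rewrite unitmxE det_diag unitfE; apply/prodf_neq0 => x _.
  by rewrite mxE rc_eq0 gt_eqF // expR_gt0.
pose A j := D j *m invmx (B j).
pose psi := tmap (fun j => A j) t.
have psiE : psi = diag_tensor w tB.
  rewrite -diag_tensorE /tB /tcoef tmap_comp; apply: eq_tmap => j x y.
  by rewrite mxE.
have sqpsi a : sqmod (psi a) = c a * expR (score (fun o a => cell_of a o) u a).
  rewrite psiE ffunE sqmodM sqmod_rc mulrC; congr (_ * _).
  rewrite score_cells /w -expR_sum -expRM_natl; congr expR.
  by rewrite -mulr_suml mulrC divfK.
have sum_psi : \sum_a sqmod (psi a) = partition_fun (fun o a => cell_of a o) c u.
  by apply: eq_bigr => a _; rewrite sqpsi.
have psiS a : psi a != 0 -> a \in tsupp B t.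
  by rewrite psiE ffunE mulf_eq0 negb_or inE => /andP[].
pose q j (x : 'I_(n j)) : R := family_marg (fun o a
  => cell_of a o) c u (Tagged (fun j => 'I_(n j)) x).
have rhoE j : reduced_density psi j = diag_mx (\row_x rc (q j x)).
  rewrite (reduced_density_free j Bf psiS); congr diag_mx; apply/rowP => x.
  rewrite !mxE sum_psi; congr (rc (_ / _)).
  by apply: eq_bigr => a _; rewrite sqpsi.
apply: (@le_trans _ _ ((\sum_j theta j * vn_entropy (reduced_density psi j))%:E + eps%:E)%E); last first.
  rewrite leeD2r //; apply: ereal_sup_ubound; exists A; split=> //.
    by move=> j; rewrite unitmx_mul Du unitmx_inv Bb.
  apply/eqP => psi0; have := partition_fun_gt0 (fun o a => cell_of a o) c0 Pd Pc u.
  rewrite -sum_psi big1 ?ltxx // => a _; apply/eqP.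
  by rewrite sqmod_eq0 /psi psi0 ffunE.
rewrite -EFinD lee_fin.
have marg1 j x : 0 <= marginal P (j := j) x <= 1.
  have [P0 P1] := Pd; rewrite sumr_ge0 //= -P1 /marginal.
  by rewrite [leRHS](bigID (fun a : idx => a j == x)) /= lerDl sumr_ge0.
have ent j : entropy (marginal P (j := j)) <=
    vn_entropy (reduced_density psi j) + (n j)%:R * 2 / ln 2 * eta.
  rewrite rhoE vn_entropy_diag !entropyE [_ / ln 2 * eta]mulrAC -mulrDl.
  rewrite ler_pM2r ?invr_gt0 // /nats_entropy.
  suff : \sum_x q j x * ln (q j x) <=
      \sum_x marginal P (j := j) x * ln (marginal P (j := j) x) + (n j)%:R * 2 * eta.
    lra.
  have -> : (n j)%:R * 2 * eta = \sum_(x : 'I_(n j)) 2 * eta.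
    by rewrite sumr_const card_ord -mulrA mulr_natl.
  rewrite -big_split /=; apply: ler_sum => x _.
  have := @xlnx_continuity R (marginal P (j := j) x) (q j x) (2 * del).
  move=> cont; apply: le_trans (cont _ _ _ _) _ => //.
  - by rewrite /q (family_marg_ge0 _ c0 Pd Pc) (family_marg_le1 _ c0 Pd Pc).
  - exact: uP.
  - by lra.
  - by rewrite lerD2l ler_pM2l.
have err : \sum_j theta j * ((n j)%:R * 2 / ln 2 * eta) <= eps.
  have -> : \sum_j theta j * ((n j)%:R * 2 / ln 2 * eta) = K * eta.
    rewrite /K !mulr_suml; apply: eq_bigr => j _; ring.
  rewrite /eta mulrCA -[leRHS]mulr1 ler_pM2l //.
  by rewrite ler_pdivrMr ?ltr_wpDl // mul1r lerDl.
apply: le_trans (lerD (lexx _) err); rewrite -big_split /=.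
by apply: ler_sum => j _; rewrite -mulrDr ler_wpM2l.
Qed.

End FreeSupport.

(** * The lower quantum functional is at most the upper one *)

Section RankBounds.
Variable F : fieldType.

(** In a full-rank factorisation M = L R, idempotence forces R L = 1, and the trace is cyclic. *)
Lemma mxtrace_idem (N : nat) (M : 'M[F]_N) : M *m M = M -> \tr M = (\rank M)%:R.
Proof.
have cancel r (A : 'M[F]_(N, r)) (B : 'M[F]_(r, N)) A' B' : A' *m A = 1%:M ->
    B *m B' = 1%:M -> A *m B *m (A *m B) = A *m B -> B *m A = 1%:M.
  move=> A'A BB' /(congr1 (fun X => A' *m X *m B')).
  by rewrite !mulmxA A'A !mul1mx -!mulmxA BB' mulmx1.
move=> MM; have /row_fullP [L' L'L] := col_base_full M.
have /row_freeP [R' RR'] := row_base_free M.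
have ML := mulmx_base M; rewrite -{1}ML mxtrace_mulC (cancel _ _ _ _ _ L'L RR').
  by rewrite mxtrace1.
by rewrite ML.
Qed.

Lemma mxrank_rows (N p : nat) (K : finType) (key : 'I_N -> K) (M : 'M[F]_(N, p)) :
  (forall i i', key i = key i' -> row i M = row i' M) -> (\rank M <= #|K|)%N.
Proof.
move=> keyP; pose X : 'M[F]_(N, #|K|) := \matrix_(i, c) (key i == enum_val c)%:R.
pose Y : 'M[F]_(#|K|, p) := \matrix_(c < #|K|)
  if [pick i | key i == enum_val c] is Some i then row i M else 0.
have -> : M = X *m Y; last exact: mulmx_max_rank.
apply/row_matrixP => i; apply/rowP => l; rewrite !mxE (bigD1 (enum_rank (key i))) //=.
rewrite !mxE enum_rankK eqxx mul1r big1 ?addr0.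
  case: pickP => [i' /eqP ki|/(_ i)]; last by rewrite eqxx.
  by have /rowP /(_ l) := keyP _ _ ki; rewrite !mxE.
move=> c cN; rewrite !mxE (_ : (key i == enum_val c) = false) ?mul0r //.
by apply: contraNF cN => /eqP ->; rewrite enum_valK.
Qed.

Lemma mxrank_sum_le (N p : nat) (I : finType) (P : pred I) (M : I -> 'M[F]_(N, p)) :
  (\rank (\sum_(i | P i) M i)%R <= \sum_(i | P i) \rank (M i))%N.
Proof.
elim/big_rec2: _ => [|i r A _ IH]; first by rewrite mxrank0.
by apply: leq_trans (mxrank_add _ _) _; rewrite leq_add2l.
Qed.

End RankBounds.

Lemma perm_of_fibers (m : nat) (T : finType) (phi phi' : 'I_m -> T) :
  (forall y, #|[set x | phi x == y]| = #|[set x | phi' x == y]|) ->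
  exists p : {perm 'I_m}, forall x, phi' x = phi (p x).
Proof.
move=> eqc; pose f := [tuple phi i | i < m]; pose f' := [tuple phi' i | i < m].
have cnt (g : 'I_m -> T) y : count_mem y [tuple g i | i < m] = #|[set x | g x == y]|.
  rewrite count_map -sum1_count big_enum_cond -sum1_card.
  by apply: eq_bigl => x; rewrite inE.
have /tuple_permP [p pP] : perm_eq f' f.
  by apply/allP => y _; rewrite /= !cnt eqc.
exists p => x; have := congr1 (fun s => nth (phi x) s x) pP.
by rewrite -!tnth_nth !tnth_mktuple.
Qed.

(** * The rank of the isotypic projections *)

Section IsotypicTrace.
Variables (R : realType) (m d : nat).
Local Notation C := (R[i]).
Local Notation G := {perm 'I_m}.
Local Notation ga := (ga R m).
Local Notation gdel := (gdel R).
Local Notation W := (word m d).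
Implicit Types (lam : seq nat) (s g h : G) (x y z : ga) (u v w : W).

Definition fmx (E : W -> W -> C) : 'M[C]_#|W| :=
  \matrix_(i, j) E (enum_val i) (enum_val j).

Lemma fmx_mul (E E' : W -> W -> C) :
  fmx E *m fmx E' = fmx (fun u w => \sum_v E u v * E' v w).
Proof.
apply/matrixP => i j; rewrite !mxE [RHS](reindex (@enum_val _ W)) /=.
  by apply: eq_bigr => l _; rewrite !mxE.
exact/onW_bij/enum_val_bij.
Qed.

Lemma fmx_trace (E : W -> W -> C) : \tr (fmx E) = \sum_w E w w.
Proof.
rewrite /mxtrace [RHS](reindex (@enum_val _ W)) /=; last exact/onW_bij/enum_val_bij.
by apply: eq_bigr => i _; rewrite mxE.
Qed.

Lemma eq_fmx (E E' : W -> W -> C) : (forall u w, E u w = E' u w) -> fmx E = fmx E'.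
Proof. by move=> EE; apply/matrixP => i j; rewrite !mxE EE. Qed.

Lemma fmx_rmxM x y : fmx (rmx (x * y)) = fmx (rmx x) *m fmx (rmx y).
Proof. by rewrite fmx_mul; apply: eq_fmx => u w; rewrite rmxM. Qed.

Lemma rmx_del_mul s x u w : rmx (gdel s * x) u w = rmx x (wact s^-1 u) w.
Proof.
rewrite rmxM (bigD1 (wact s^-1 u)) //= rmx_del wactVK eqxx mul1r big1 ?addr0 //.
move=> v vu; rewrite rmx_del (can2_eq (@wactK m d s) (@wactVK m d s)).
by rewrite (negPf vu) mul0r.
Qed.

(** The matrix row at a word depends only on how often each letter occurs in each row of the
    tableau: words with equal counts differ by a row permutation. *)
Lemma row_sum_rank lam : is_partition m lam ->
  (\rank (fmx (rmx (row_sum R m lam))) <= m.+1 ^ (size lam * d))%N.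
Proof.
move=> pl; have lm := partition_sum pl.
pose cnt (u : W) (c : 'I_(size lam) * 'I_d) :=
  #|[set a : 'I_m | (reshape_index lam a == c.1) && (u a == c.2)]|.
pose key (i : 'I_#|W|) : {ffun 'I_(size lam) * 'I_d -> 'I_m.+1} :=
  [ffun c => inord (cnt (enum_val i) c)].
have -> : (m.+1 ^ (size lam * d) =
    #|{: {ffun 'I_(size lam) * 'I_d -> 'I_m.+1}}|)%N.
  by rewrite card_ffun card_prod !card_ord.
apply: (mxrank_rows (key := key)) => i i' ki.
set u := enum_val i; set u' := enum_val i'.
have cntE c : cnt u c = cnt u' c.
  have : key i c = key i' c by rewrite ki.
  move=> /(congr1 val); rewrite !ffunE /= !inordK // ltnS.
    by rewrite -[leqRHS]card_ord max_card.
  by rewrite -[leqRHS]card_ord max_card.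
have rl (a : 'I_m) : (reshape_index lam a < size lam)%N.
  by apply: reshape_indexP; rewrite lm.
pose phi (v : W) (a : 'I_m) := (Ordinal (rl a), v a).
have [p pP] : exists p : G, forall a, phi u' a = phi u (p a).
  apply: perm_of_fibers => c.
  have phiE v : #|[set x | phi v x == c]| = cnt v c.
    by apply: eq_card => a; rewrite !inE -pair_eqE.
  by rewrite !phiE cntE.
have u'E : u' = wact p u by apply/ffunP => a; rewrite ffunE; case: (pP a).
have pR : p \in row_stab m lam.
  by apply/row_stabP => a; have [] := pP a.
apply/rowP => l; rewrite !mxE -/u -/u' u'E -{2}(gdel_row_sum R pR) rmx_del_mul.
by rewrite wactK.
Qed.


(** The trace is the rank. The idempotent is a sum of products (g a) x with a the row symmetrizer; g
    a depends only on the coset of g, and cosets are words of type [lam], of which there are at most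
    exp(m H). *)
Lemma iso_idem_trace lam : (0 < m)%N -> is_partition m lam ->
  exists2 r : nat, \sum_(w : W) rmx (iso_idem R m lam) w w = (r%:R : C) &
    (r%:R : R) <= expR (m%:R * nats_entropy (fun i : 'I_(size lam) =>
       (nth 0%N lam i)%:R / m%:R)) * (m.+1 ^ (size lam * d))%:R.
Proof.
move=> m0 pl; have lm := partition_sum pl; set e := iso_idem R m lam.
exists (\rank (fmx (rmx e))).
  rewrite -fmx_trace mxtrace_idem // -fmx_rmxM; congr (fmx (rmx _)).
  exact: two_sided_idem_idem.
have rl g (a : 'I_m) : (reshape_index lam (g a) < size lam)%N.
  by apply: reshape_indexP; rewrite lm.
(* The row of [lam] into which [g] sends each position; it determines the coset of [g] modulo the
   row stabilizer. *)
pose rw g : {ffun 'I_m -> 'I_(size lam)} := [ffun a => Ordinal (rl g a)].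
pose T := [set w : {ffun 'I_m -> 'I_(size lam)} |
  [forall i, #|[set x | w x == i]| == nth 0%N lam i]].
have rwT g : rw g \in T.
  rewrite inE; apply/forallP => i; rewrite -(card_row i lm).
  rewrite -[X in _ == X](card_imset _ (@perm_inj _ g^-1%g)).
  apply/eqP; apply: eq_card => a; rewrite inE ffunE -val_eqE /=.
  apply/idP/imsetP => [ga|[b]]; first by exists (g a); rewrite ?inE // permK.
  by rewrite inE => bi ->; rewrite permKV.
pose rep (w : {ffun 'I_m -> 'I_(size lam)}) := odflt 1%g [pick g | rw g == w].
have repP g : gdel g * row_sum R m lam = gdel (rep (rw g)) * row_sum R m lam.
  rewrite /rep; case: pickP => [g' /eqP rg|/(_ g)]; last by rewrite eqxx.
  have pR : (g'^-1 * g)%g \in row_stab m lam.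
    apply/row_stabP => a; rewrite permM.
    have := congr1 (fun f : {ffun 'I_m -> 'I_(size lam)}
      => val (f (g'^-1%g a))) (esym rg).
    by rewrite !ffunE /= permKV.
  by rewrite -{2}(gdel_row_sum R pR) mulrA -gdelM mulKVg.
have /two_sidedP [beta eE] := two_sided_idem_in (young R m lam).
pose X g : ga := \sum_h beta g h *: (col_asum R m lam * gdel h).
have eX : e = \sum_g (gdel (rep (rw g)) * row_sum R m lam) * X g.
  rewrite /e /iso_idem eE; apply: eq_bigr => g _; rewrite mulr_sumr.
  apply: eq_bigr => h _; rewrite -scalerAr -repP young_mul; congr (_ *: _).
  by rewrite !mulrA.
have -> : fmx (rmx e) = \sum_(w in T) (fmx (rmx (gdel (rep w))) *m
    fmx (rmx (row_sum R m lam))) *m fmx (rmx (\sum_(g | rw g == w) X g)).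
  transitivity (fmx (rmx (\sum_(w in T) (gdel (rep w) * row_sum R m lam) *
      \sum_(g | rw g == w) X g))).
    congr (fmx (rmx _)); rewrite eX (partition_big rw (mem T)) //=.
    by apply: eq_bigr => w _; rewrite mulr_sumr; apply: eq_bigr => g /eqP ->.
  apply/matrixP => i j; rewrite summxE mxE big_mkcond rmx_sum [RHS]big_mkcond /=.
  apply: eq_bigr => w _; case: ifP => _; last by rewrite /rmx big1 // => s _;
    rewrite ga_0E mul0r.
  by rewrite -!fmx_rmxM mxE.
apply: (@le_trans _ _ (#|T| * m.+1 ^ (size lam * d))%:R).
  rewrite ler_nat; apply: leq_trans (mxrank_sum_le _ _) _.
  rewrite -sum_nat_const; apply: leq_sum => w _.
  apply: leq_trans (mxrankM_maxl _ _) _; apply: leq_trans (mxrankM_maxr _ _) _.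
  exact: row_sum_rank.
rewrite natrM ler_wpM2r //; apply: card_type_words => //.
by rewrite sum_nth_take take_size.
Qed.

End IsotypicTrace.

(** * Partial traces and spectra of reduced densities *)

Section PartialTrace.
Variables (R : realType) (k : nat).
Local Notation C := (R[i]).
Local Notation rc := (real_complex R).

Definition agree_off (I : 'I_k -> finType) (j : 'I_k) (a b : midx I) : bool :=
  [forall l, (l != j) ==> (a l == b l)].

(** Left unnormalised and with arbitrary index types, so that it serves both a tensor and its tensor
    power. *)
Definition partial_trace (I : 'I_k -> finType) (j : 'I_k) (t : tens R I) (x y : I j) : C :=
  \sum_a \sum_b t a * (t b)^* * [&& a j == x, b j == y & agree_off j a b]%:R.

Lemma agree_offP (I : 'I_k -> finType) (j : 'I_k) (a b : midx I) :
  agree_off j a b -> a j = b j -> a = b.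
Proof.
move=> /forallP ab abj; apply/ffunP => l; have [->//|lj] := eqVneq l j.
by have := ab l; rewrite lj => /eqP.
Qed.

Lemma agree_off_refl (I : 'I_k -> finType) (j : 'I_k) (a : midx I) : agree_off j a a.
Proof. by apply/forallP => l; rewrite eqxx implybT. Qed.

Lemma agree_off_sym (I : 'I_k -> finType) (j : 'I_k) (a b : midx I) :
  agree_off j a b = agree_off j b a.
Proof. by apply: eq_forallb => l; rewrite (eq_sym (a l)). Qed.

Lemma prod_bool (T : finType) (B : pred T) :
  \prod_x (B x)%:R = [forall x, B x]%:R :> C.
Proof.
case: (boolP [forall x, B x]) => [/forallP Bx|].
  by rewrite big1 // => x _; rewrite Bx.
by rewrite negb_forall => /existsP [x /negPf Bx]; rewrite (bigD1 x) //= Bx mul0r.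
Qed.

(** The expectation of an operator on factor j is its trace against the partial trace. *)
Lemma partial_trace_expand (I : 'I_k -> finType) (j : 'I_k) (t : tens R I)
    (E : I j -> I j -> C) :
  \sum_(u : midx I) \sum_(v : midx I) (t u)^* * (E (u j) (v j) * (agree_off j u v)%:R) * t v =
  \sum_p \sum_q E p q * partial_trace t q p.
Proof.
rewrite exchange_big /= [LHS]pair_big [RHS]pair_big /=.
transitivity (\sum_(uv : midx I * midx I) \sum_(pq : I j * I j)
    E pq.1 pq.2 * (t uv.1 * (t uv.2)^* *
      [&& uv.1 j == pq.2, uv.2 j == pq.1 & agree_off j uv.1 uv.2]%:R)).
  apply: eq_bigr => -[v u] _ /=.
  rewrite (bigD1 (u j, v j)) //= !eqxx big1 ?addr0.
    by rewrite agree_off_sym; ring.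
  move=> [p q] /= pq; case: eqP => [vq|_]; last by rewrite /= !mulr0.
  case: eqP => [up|_]; last by rewrite /= !mulr0.
  by case/eqP: pq; rewrite vq up.
rewrite exchange_big; apply: eq_bigr => -[p q] _ /=.
by rewrite /partial_trace pair_big mulr_sumr.
Qed.

(** Agreement off j is an equivalence relation, so the sum splits by classes into squared moduli;
    [rest] names the class, with [None] at position j. *)
Lemma rest_gram_ge0 (I : 'I_k -> finType) (j : 'I_k) (f : midx I -> C) :
  0 <= \sum_a \sum_b f a * (f b)^* * (agree_off j a b)%:R.
Proof.
pose rest (a : midx I) : {ffun 'I_k -> option {l & I l}} :=
  [ffun l => if l == j then None else Some (Tagged I (a l))].
have restE a b : agree_off j a b = (rest a == rest b).
  apply/forallP/eqP => [ab|ab l].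
    apply/ffunP => l; rewrite !ffunE; case: eqP => // /eqP lj.
    by have := ab l; rewrite lj => /eqP ->.
  apply/implyP => lj; have /eqP := congr1 (fun g : {ffun _ -> _} => g l) ab.
  by rewrite !ffunE (negPf lj) (inj_eq Some_inj) eq_Tagged.
rewrite (partition_big rest xpredT) //=; apply: sumr_ge0 => c _.
suff -> : \sum_(a | rest a == c) \sum_b f a * (f b)^* * (agree_off j a b)%:R =
    (\sum_(a | rest a == c) f a) * (\sum_(a | rest a == c) f a)^*.
  exact: mul_conjC_ge0.
rewrite mulr_suml; apply: eq_bigr => a /eqP ac.
rewrite rmorph_sum mulr_sumr [RHS]big_mkcond; apply: eq_bigr => b _ /=.
by rewrite restE ac eq_sym; case: eqP; rewrite ?mulr1 ?mulr0.
Qed.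

Variable n : 'I_k -> nat.
Local Notation idx := (midx (fun j => 'I_(n j) : finType)).

Definition word_of (m : nat) (f : {ffun 'I_m -> idx}) : midx (fun j => word m (n j)) :=
  [ffun j => [ffun x => f x j]].

Lemma word_of_bij (m : nat) : bijective (@word_of m).
Proof.
exists (fun w => [ffun x => letter w x]) => [f|w].
  by apply/ffunP => x; rewrite ffunE; apply/ffunP => j; rewrite !ffunE.
by apply/ffunP => j; rewrite ffunE; apply/ffunP => x; rewrite !ffunE.
Qed.

Lemma tens_pow_word_of (m : nat) (t : tensor R n) (f : {ffun 'I_m -> idx}) :
  tens_pow m t (word_of f) = \prod_x t (f x).
Proof.
rewrite tens_powE; apply: eq_bigr => x _; congr (t _).
by apply/ffunP => j; rewrite !ffunE.
Qed.

Lemma partial_trace_pow (m : nat) (t : tensor R n) j (p q : word m (n j)) :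
  @partial_trace (fun j => word m (n j)) j (tens_pow m t) p q =
  \prod_x @partial_trace (fun j => 'I_(n j) : finType) j t (p x) (q x).
Proof.
rewrite /partial_trace.
rewrite (bigA_distr_bigA (fun x (a : idx) => \sum_b t a * (t b)^* *
  [&& a j == p x, b j == q x & agree_off j a b]%:R)) /=.
rewrite (reindex (@word_of m)) /=; last exact/onW_bij/word_of_bij.
apply: eq_bigr => f _.
rewrite (bigA_distr_bigA (fun x (b : idx) => t (f x) * (t b)^* *
  [&& f x j == p x, b j == q x & agree_off j (f x) b]%:R)) /=.
rewrite (reindex (@word_of m)) /=; last exact/onW_bij/word_of_bij.
apply: eq_bigr => g _; rewrite !big_split /= !tens_pow_word_of rmorph_prod.
congr (_ * _ * _); rewrite (prod_bool (fun x => [&& f x j == p x, g x j == q x &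
  agree_off j (f x) (g x)])); congr (_ : bool)%:R.
apply/and3P/forallP => [[/eqP fp /eqP gq /forallP fg] x|H].
  rewrite -fp -gq !ffunE !eqxx /=; apply/forallP => l; apply/implyP => lj.
  have := fg l; rewrite lj /= => /eqP fgl.
  by have := congr1 (fun w : word m (n l) => w x) fgl; rewrite !ffunE => ->.
split.
- by apply/eqP/ffunP => x; have /and3P [/eqP <- _ _] := H x; rewrite !ffunE.
- by apply/eqP/ffunP => x; have /and3P [_ /eqP <- _] := H x; rewrite !ffunE.
- apply/forallP => l; apply/implyP => lj; apply/eqP/ffunP => x.
  have /and3P [_ _ /forallP /(_ l)] := H x; rewrite lj /= => /eqP fgl.
  by rewrite !ffunE.
Qed.

Definition sqnorm (I : 'I_k -> finType) (t : tens R I) : R := \sum_a sqmod (t a).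

Lemma sqnormE (I : 'I_k -> finType) (t : tens R I) :
  \sum_a t a * (t a)^* = rc (sqnorm t).
Proof. by rewrite /sqnorm rc_sum; apply: eq_bigr => a _; rewrite sqmodE. Qed.

Lemma sqnorm_gt0 (I : 'I_k -> finType) (t : tens R I) : t != 0 -> 0 < sqnorm t.
Proof.
move=> t0; rewrite lt_def sumr_ge0 ?andbT; last by move=> a _; apply: sqmod_ge0.
apply: contra_neq t0 => /psumr_eq0P s0; apply/ffunP => a; rewrite ffunE.
by apply/eqP; rewrite -sqmod_eq0 s0 // => b _; apply: sqmod_ge0.
Qed.

Lemma reduced_densityE (t : tensor R n) j x y :
  reduced_density t j x y = partial_trace t x y / rc (sqnorm t).
Proof.
rewrite mxE -sqnormE /partial_trace mulr_suml big_mkcond; apply: eq_bigr => a _.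
rewrite mulr_suml; case: eqP => [ax|_] /=; last first.
  by rewrite big1 // => b _; rewrite mulr0 mul0r.
rewrite big_mkcond; apply: eq_bigr => b _; rewrite /density.
by rewrite -/(agree_off j a b); case: ifP => _; rewrite ?mulr1 ?mulr0 ?mul0r.
Qed.

Lemma partial_trace_conj (I : 'I_k -> finType) j (t : tens R I) x y :
  (partial_trace (j := j) t y x)^* = partial_trace t x y.
Proof.
rewrite /partial_trace rmorph_sum exchange_big; apply: eq_bigr => b _.
rewrite rmorph_sum; apply: eq_bigr => a _ /=.
rewrite !rmorphM /= conjCK rmorph_nat mulrC [_^* * _]mulrC agree_off_sym.
by rewrite mulrC andbCA.
Qed.

Lemma reduced_density_normal (t : tensor R n) j : reduced_density t j \is normalmx.
Proof.
apply/normalmxP; suff -> : ((reduced_density t j)^T ^ Num.conj_op)%sesqui = reduced_density t j by [].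
apply/matrixP => x y; rewrite 2!mxE !reduced_densityE rmorphM fmorphV /=.
rewrite partial_trace_conj; congr (_ / _); exact: conjc_real.
Qed.

Definition spectrum (t : tensor R n) j (x : 'I_(n j)) : R :=
  complex.Re (spectral_diag (reduced_density t j) 0 x).

(** An eigenvalue is a diagonal entry of the conjugated density, hence a normalised Gram sum. *)
Lemma spectral_diag_ge0 (t : tensor R n) j x :
  0 <= spectral_diag (reduced_density t j) 0 x.
Proof.
set rho := reduced_density t j; set P := spectralmx rho.
have /orthomx_spectralP := reduced_density_normal t j; rewrite -/rho -/P => rhoE.
have Pu : P \in unitmx by exact: spectral_unit.
have DE : diag_mx (spectral_diag rho) = P *m rho *m (P^T ^ Num.conj_op)%sesqui.
  rewrite -invmx_unitary ?spectral_unitarymx // [in RHS]rhoE.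
  by rewrite !mulmxA mulmxV // mul1mx -mulmxA mulmxV // mulmx1.
have -> : spectral_diag rho 0 x = diag_mx (spectral_diag rho) x x.
  by rewrite mxE eqxx mulr1n.
rewrite DE mxE.
have -> : \sum_y (P *m rho) x y * (P^T ^ Num.conj_op)%sesqui y x =
    (\sum_(a : idx) \sum_(b : idx) (P x (a j) * t a) * (P x (b j) * t b)^* * (agree_off j a b)%:R) /
    rc (sqnorm t).
  transitivity ((\sum_p \sum_q (P x q * (P x p)^*) * partial_trace t q p) / rc (sqnorm t)).
    rewrite mulr_suml; apply: eq_bigr => y _; rewrite !mxE !mulr_suml.
    by apply: eq_bigr => z _; rewrite reduced_densityE; ring.
  rewrite -(partial_trace_expand (j := j) t (fun p q => P x q * (P x p)^*)).
  rewrite exchange_big; congr (_ / _); apply: eq_bigr => a _; apply: eq_bigr => b _.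
  by rewrite rmorphM agree_off_sym; ring.
rewrite divr_ge0 ?rest_gram_ge0 // ler0c sumr_ge0 // => a _; exact: sqmod_ge0.
Qed.

Lemma spectral_diagE (t : tensor R n) j x :
  spectral_diag (reduced_density t j) 0 x = rc (spectrum t x).
Proof. by apply/esym/RRe_real/ger0_real/spectral_diag_ge0. Qed.

Lemma spectrum_dist (t : tensor R n) j : t != 0 -> is_dist (spectrum t (j := j)).
Proof.
move=> t0; split=> [x|]; first by rewrite -ler0c -spectral_diagE spectral_diag_ge0.
apply: rc_inj; rewrite rc_sum.
transitivity (\tr (diag_mx (spectral_diag (reduced_density t j)))).
  by apply: eq_bigr => x _; rewrite mxE eqxx mulr1n spectral_diagE.
have /orthomx_spectralP := reduced_density_normal t j.
set P := spectralmx _ => rhoE.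
transitivity (\tr (reduced_density t j)).
  rewrite [in RHS]rhoE -mulmxA mxtrace_mulC -mulmxA mulmxV ?mulmx1 //.
  exact: spectral_unit.
have N0 : rc (sqnorm t) != 0 by rewrite rc_eq0 gt_eqF // sqnorm_gt0.
rewrite /mxtrace; under eq_bigr => x _ do rewrite reduced_densityE.
rewrite -mulr_suml; apply: (canLR (mulfK N0)); rewrite mul1r -sqnormE.
rewrite /partial_trace exchange_big; apply: eq_bigr => a _ /=.
rewrite (bigD1 (a j)) //= (bigD1 a) //= !eqxx agree_off_refl mulr1.
rewrite big1 ?addr0; last first.
  move=> b ba; rewrite (_ : [&& _, _ & _] = false) ?mulr0 //;
    apply/and3P => -[_ /eqP bj ab].
  by case/eqP: ba; apply: (agree_offP (j := j)); rewrite // agree_off_sym.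
rewrite big1 ?addr0 // => x xa; rewrite big1 // => b _.
by rewrite eq_sym (negPf xa) mulr0.
Qed.

End PartialTrace.

(** * Shapes of small entropy carry little weight *)

Section RareShapes.
Variables (R : realType) (m d : nat).
Local Notation C := (R[i]).
Local Notation rc := (real_complex R).
Local Notation W := (word m d).
Implicit Types (lam : seq nat) (u v w : W).

(** Equals the diagonal entry of the projection, since that is idempotent and self-adjoint; in this
    form it is visibly real and nonnegative. *)
Definition iso_diag lam w : R := \sum_v sqmod (rmx (iso_idem R m lam) w v).

Lemma iso_diagE lam w : rmx (iso_idem R m lam) w w = rc (iso_diag lam w).
Proof.
rewrite -iso_idem_rmx_idem rc_sum; apply: eq_bigr => v _.
by rewrite -sqmodE iso_idem_herm.
Qed.

Lemma iso_diag_ge0 lam w : 0 <= iso_diag lam w.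
Proof. by apply: sumr_ge0 => v _; apply: sqmod_ge0. Qed.

Lemma iso_diag_le1 lam w : iso_diag lam w <= 1.
Proof.
have : iso_diag lam w ^+ 2 <= iso_diag lam w.
  rewrite -sqmod_rc -iso_diagE {1}/iso_diag (bigD1 w) //= lerDl sumr_ge0 // => v _.
  exact: sqmod_ge0.
have [->|g0 le1] := eqVneq (iso_diag lam w) 0; first by rewrite ler01.
have gp : 0 < iso_diag lam w by rewrite lt_def g0 iso_diag_ge0.
by rewrite -(ler_pM2l gp) mulr1 -expr2.
Qed.

(** Only d letters are available, so dominance puts all m boxes into the first d rows. *)
Lemma iso_diag_tall lam w : is_partition m lam -> (d < size lam)%N ->
  iso_diag lam w = 0.
Proof.
move=> pl dl; apply: rc_inj; rewrite -iso_diagE; apply/eqP/negPn/negP.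
move=> /(iso_idem_dominates (enum 'I_d) pl); apply/negP; rewrite -ltnNge size_enum_ord.
have -> : #|[set x | w x \in enum 'I_d]| = m.
  by rewrite -[RHS]card_ord; apply: eq_card => x; rewrite inE mem_enum.
rewrite sum_nth_take -[ltnRHS](partition_sum pl) -{2}(cat_take_drop d lam) sumn_cat.
rewrite -[ltnLHS]addn0 ltn_add2l (drop_nth 0%N dl) /=.
by apply: leq_trans (partition_nth_gt0 pl dl) _; rewrite leq_addr.
Qed.

Lemma sum_iso_diag lam : (0 < m)%N -> is_partition m lam -> (size lam <= d)%N ->
  \sum_w iso_diag lam w <= expR (m%:R * nats_entropy (fun i : 'I_(size lam) =>
       (nth 0%N lam i)%:R / m%:R)) * m.+1%:R ^+ (d * d).
Proof.
move=> m0 pl sd; have [r rE rle] := @iso_idem_trace R m d lam m0 pl.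
have -> : \sum_w iso_diag lam w = r%:R.
  apply: rc_inj; rewrite rc_sum; under eq_bigr => w _ do rewrite -iso_diagE.
  by rewrite rE; apply/esym; exact: (rmorph_nat rc).
apply: le_trans rle _; rewrite ler_wpM2l ?expR_ge0 // -natrX ler_nat.
by rewrite leq_exp2l // leq_mul2r sd orbT.
Qed.

(* Markov-type estimate: the product weight of a word either is below the typical
   value or is dominated by its (1+s)-th power, suitably rescaled. *)
Lemma rare_shape (r : 'I_d -> R) lam (del s : R) : is_dist r -> (0 < m)%N ->
  is_partition m lam -> 0 < del -> 0 < s -> s <= 1 ->
  s * \sum_x r x * ln (r x) ^+ 2 <= del / 2 ->
  nats_entropy (fun i : 'I_(size lam) => (nth 0%N lam i)%:R / m%:R : R) <
    nats_entropy r - 2 * del ->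
  \sum_w iso_diag lam w * \prod_x r (w x) <=
  2 * (m.+1%:R ^+ (d * d) * expR (- (m%:R * (s * del / 2)))).
Proof.
move=> rd m0 pl del0 s0 s1 sK lamH; have [r0 r1] := rd.
have [sd|dl] := leqP (size lam) d; last first.
  rewrite big1 => [|w _]; last by rewrite iso_diag_tall // mul0r.
  by rewrite !mulr_ge0 ?exprn_ge0 ?expR_ge0.
set H := nats_entropy r in lamH *; set M : R := m%:R.
have M0 : 0 < M by rewrite ltr0n.
(* [tau] is the cut-off exp(-m (H - del)), and tau' = tau^(-s), so above the cut-off tau' times the
   s-th power of the weight is at least 1. *)
pose tau := expR (- (M * (H - del))); pose tau' := expR (s * (M * (H - del))).
have weight (w : W) : \prod_x r (w x) <=
    tau + tau' * \prod_x (r (w x) * expR (s * ln (r (w x)))).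
  have p0 : 0 <= \prod_x (r (w x) * expR (s * ln (r (w x)))).
    by apply: prodr_ge0 => x _; rewrite mulr_ge0 ?expR_ge0.
  have [w0|wN0] := eqVneq (\prod_x r (w x)) 0.
    by rewrite w0 addr_ge0 ?mulr_ge0 ?expR_ge0.
  have rw0 x : 0 < r (w x).
    by rewrite lt_def r0 andbT; apply: contra_neq wN0 => rx;
      rewrite (bigD1 x) //= rx mul0r.
  have -> : \prod_x r (w x) = expR (\sum_x ln (r (w x))).
    by rewrite expR_sum; apply: eq_bigr => x _; rewrite lnK // posrE.
  rewrite big_split /=.
  have -> : \prod_x r (w x) = expR (\sum_x ln (r (w x))).
    by rewrite expR_sum; apply: eq_bigr => x _; rewrite lnK // posrE.
  rewrite -expR_sum -mulr_sumr; set L := \sum_x _.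
  have [le|gt] := leP L (- (M * (H - del))).
    by rewrite -[leLHS]addr0 lerD ?ler_expR // mulr_ge0 ?mulr_ge0 ?expR_ge0.
  rewrite -[leLHS]add0r lerD ?expR_ge0 // mulrCA ler_peMr ?expR_ge0 //.
  rewrite /tau' -expRD -mulrDr; apply: le_trans (expR_ge1Dx _).
  by rewrite lerDl mulr_ge0 ?(ltW s0) //; lra.
apply: (@le_trans _ _ (\sum_w (tau * iso_diag lam w +
    tau' * \prod_x (r (w x) * expR (s * ln (r (w x))))))).
  apply: ler_sum => w _; apply: le_trans (ler_wpM2l (iso_diag_ge0 lam w) (weight w)) _.
  rewrite mulrDr [tau * _]mulrC lerD2l ler_piMl ?iso_diag_le1 //.
  by rewrite mulr_ge0 ?expR_ge0 // prodr_ge0 // => x _; rewrite mulr_ge0 ?expR_ge0.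
rewrite big_split /= -!mulr_sumr.
have -> : \sum_(w : W) \prod_x (r (w x) * expR (s * ln (r (w x)))) =
    (\sum_x r x * expR (s * ln (r x))) ^+ m.
  rewrite -[X in _ ^+ X]card_ord -prodr_const.
  by rewrite (bigA_distr_bigA (fun (_ : 'I_m) y => r y * expR (s * ln (r y)))).
have sdel : s * del / 2 <= del.
  have : s * del <= 1 * del by rewrite ler_pM2r.
  lra.
have poly1 : 1 <= m.+1%:R ^+ (d * d) :> R by rewrite exprn_ege1 // ler1n.
(* The trace grows at most like exp(m (H - 2 del)) up to a polynomial; against the cut-off this
   leaves exp(-m del). *)
have part1 : tau * \sum_w iso_diag lam w <=
    m.+1%:R ^+ (d * d) * expR (- (M * (s * del / 2))).
  apply: le_trans (ler_wpM2l (expR_ge0 _) (sum_iso_diag m0 pl sd)) _.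
  rewrite -/M; set h := nats_entropy _ in lamH *.
  rewrite [expR (M * h) * _]mulrC mulrCA; apply: ler_wpM2l; first exact: exprn_ge0.
  rewrite /tau -expRD ler_expR.
  have : M * h <= M * (H - 2 * del) by rewrite ler_pM2l // ltW.
  have : M * (s * del / 2) <= M * del by rewrite ler_pM2l.
  lra.
(* The terms in H cancel and the exponent is m (s^2 K - s del), at most -m s del / 2 by the choice
   of [s]. *)
have part2 : tau' * (\sum_x r x * expR (s * ln (r x))) ^+ m <=
    m.+1%:R ^+ (d * d) * expR (- (M * (s * del / 2))).
  apply: (@le_trans _ _ (1 * expR (- (M * (s * del / 2))))); last first.
    by rewrite ler_wpM2r ?expR_ge0.
  rewrite mul1r.
  have := sum_power_le rd (ltW s0); rewrite -/H.
  set Z := \sum_x r x * expR _; set K := \sum_x _ * _ ^+ 2 => Zle.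
  have Z0 : 0 <= Z by apply: sumr_ge0 => x _; rewrite mulr_ge0 ?expR_ge0.
  apply: (@le_trans _ _ (tau' * expR (- (s * H) + s ^+ 2 * K) ^+ m)).
    by rewrite ler_wpM2l ?expR_ge0 // lerXn2r ?nnegrE ?expR_ge0.
  rewrite -expRM_natl -/M /tau' -expRD ler_expR.
  have -> : s * (M * (H - del)) + M * (- (s * H) + s ^+ 2 * K) =
      M * (s * (s * K) - s * del) by ring.
  rewrite -[leRHS]mulrN ler_pM2l //.
  have : s * (s * K) <= s * (del / 2) by rewrite ler_pM2l.
  lra.
lra.
Qed.

End RareShapes.

(** * Weights of tuples of shapes in a tensor power *)

Section LowerLeUpper.
Variables (R : realType) (k : nat) (n : 'I_k -> nat).
Local Notation C := (R[i]).
Local Notation rc := (real_complex R).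
Local Notation idx := (midx (fun j => 'I_(n j) : finType)).
Local Notation widx m := (midx (fun j => word m (n j))).
Implicit Types (t : tensor R n) (m : nat).

Lemma mpow_mul m d (A B : 'M[C]_d) (u w : word m d) :
  \sum_v mpow A u v * mpow B v w = mpow (A *m B) u w.
Proof.
rewrite /mpow; under [RHS]eq_bigr => x _ do rewrite mxE.
rewrite (bigA_distr_bigA (fun x y => A (u x) y * B y (w x))) /=.
by apply: eq_bigr => v _; rewrite big_split.
Qed.

(** [E] commutes with tensor powers of matrices, so conjugation by the m-th power of [P] cancels
    under the trace. *)
Lemma trace_mpow m d (E : word m d -> word m d -> C) (A P : 'M[C]_d) (D : 'rV[C]_d) :
  (forall B u w, \sum_v E u v * mpow B v w = \sum_v mpow B u v * E v w) ->
  P \in unitmx -> A = invmx P *m diag_mx D *m P ->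
  \sum_p \sum_q E p q * mpow A q p = \sum_w E w w * \prod_x D 0 (w x).
Proof.
move=> EB Pu AE.
have mm (B B' : 'M[C]_d) : fmx (mpow (m := m) (B *m B')) = fmx (mpow B) *m fmx (mpow B').
  by rewrite fmx_mul; apply: eq_fmx => u w; rewrite mpow_mul.
have Ecomm (B : 'M[C]_d) : fmx E *m fmx (mpow B) = fmx (mpow B) *m fmx E.
  by rewrite !fmx_mul; apply: eq_fmx => u w; rewrite EB.
transitivity (\tr (fmx E *m fmx (mpow A))).
  by rewrite fmx_mul fmx_trace.
transitivity (\tr (fmx E *m fmx (mpow (diag_mx D)))).
  rewrite AE !mm !mulmxA mxtrace_mulC !mulmxA -Ecomm -(mulmxA (fmx E)) -mm mulmxV //.
  congr (\tr (_ *m _)); rewrite -[RHS]mulmx1; congr (_ *m _).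
  apply/matrixP => i j; rewrite !mxE /mpow.
  under eq_bigr => x _ do rewrite mxE.
  rewrite prod_bool -(inj_eq enum_val_inj); congr (_ : bool)%:R.
  by apply/forallP/eqP => [ij|-> //]; apply/ffunP => x; apply/eqP.
rewrite fmx_mul fmx_trace; apply: eq_bigr => w _.
rewrite (bigD1 w) //= big1 ?addr0.
  by congr (_ * _); apply: eq_bigr => x _; rewrite mxE eqxx mulr1n.
move=> v vw; have /existsP [x vx] : [exists x, v x != w x].
  rewrite -negb_forall; apply: contra vw => /forallP vw.
  by apply/eqP/ffunP => x; apply/eqP.
by rewrite /mpow (bigD1 x) //= mxE (negPf vx) mulr0n mul0r mulr0.
Qed.

Lemma rcX (x : R) m : rc (x ^+ m) = rc x ^+ m.
Proof. by elim: m => [|m IHm]; rewrite ?expr0 // !exprS rcM IHm. Qed.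

Lemma sum_iso_trace t m j lam : t != 0 ->
  \sum_(u : widx m) \sum_(v : widx m) (tens_pow m t u)^* *
    (rmx (iso_idem R m lam) (u j) (v j) * (agree_off j u v)%:R) * tens_pow m t v =
  rc (sqnorm t ^+ m * \sum_(w : word m (n j)) iso_diag R lam w * \prod_x spectrum t (w x)).
Proof.
move=> t0; rewrite (@partial_trace_expand R k (fun j => word m (n j)) j).
have N0 : rc (sqnorm t) != 0 by rewrite rc_eq0 gt_eqF // sqnorm_gt0.
transitivity (rc (sqnorm t) ^+ m * \sum_p \sum_q rmx (iso_idem R m lam) p q *
    mpow (reduced_density t j) q p).
  rewrite mulr_sumr; apply: eq_bigr => p _; rewrite mulr_sumr; apply: eq_bigr => q _.
  rewrite partial_trace_pow mulrCA; congr (_ * _).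
  rewrite -[X in _ ^+ X]card_ord -prodr_const -big_split /=; apply: eq_bigr => x _.
  by rewrite reduced_densityE mulrC divfK.
have /orthomx_spectralP rhoE := reduced_density_normal t j.
rewrite (trace_mpow _ (spectral_unit _) rhoE); last first.
  by move=> B u w; apply: rmx_commute => s u' w'; apply: mpow_act.
rewrite rcM rcX; congr (_ * _); rewrite rc_sum.
apply: eq_bigr => w _; rewrite rcM rc_prod -iso_diagE; congr (_ * _).
by apply: eq_bigr => x _; rewrite spectral_diagE.
Qed.

Lemma tmapE (I : 'I_k -> finType) (A : forall j, I j -> I j -> C) (z : tens R I) a :
  tmap A z a = \sum_(b : midx I) (\prod_j A j (a j) (b j)) * z b.
Proof. by rewrite ffunE. Qed.

Definition iso_component t m (L : {ffun 'I_k -> partn m}) :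
    tens R (fun j => word m (n j)) :=
  tmap (fun j => rmx (iso_idem R m (ssval (L j)))) (tens_pow m t).

Definition iso_weight t m (L : {ffun 'I_k -> partn m}) : R := sqnorm (iso_component t L).

(** For a self-adjoint idempotent e, the squared norm of e t is the inner product of t with e t;
    being linear in e, this form can be summed over shapes. *)
Lemma iso_weightE t m (L : {ffun 'I_k -> partn m}) :
  rc (iso_weight t L) = \sum_(u : widx m) \sum_(v : widx m) (tens_pow m t u)^* *
    (\prod_j rmx (iso_idem R m (ssval (L j))) (u j) (v j)) * tens_pow m t v.
Proof.
transitivity (\sum_u (tens_pow m t u)^* * iso_component t L u); last first.
  apply: eq_bigr => u _; rewrite /iso_component tmapE mulr_sumr; apply: eq_bigr => v _.
  by rewrite mulrA.
have -> : iso_component t L =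
    tmap (fun j => rmx (iso_idem R m (ssval (L j)))) (iso_component t L).
  rewrite /iso_component tmap_comp; apply: eq_tmap => j x y.
  by rewrite iso_idem_rmx_idem.
rewrite /iso_weight -sqnormE; set phi := iso_component t L.
under [RHS]eq_bigr => u _ do rewrite tmapE mulr_sumr.
rewrite exchange_big; apply: eq_bigr => v _ /=.
rewrite /phi {2}/iso_component tmapE rmorph_sum /= mulrC mulr_suml.
apply: eq_bigr => u _; rewrite rmorphM rmorph_prod mulrA [_ * (_)^*]mulrC.
by congr (_ * _ * _); apply: eq_bigr => j _; exact: iso_idem_herm.
Qed.

Lemma sum_iso_weight t m j (nu : partn m) : t != 0 ->
  \sum_(L : {ffun 'I_k -> partn m} | L j == nu) iso_weight t L =
  sqnorm t ^+ m * \sum_(w : word m (n j)) iso_diag R (ssval nu) w * \prod_x spectrum t (j := j) (w x).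
Proof.
move=> t0; apply: rc_inj; rewrite -sum_iso_trace // rc_sum.
under eq_bigr => L _ do rewrite iso_weightE.
rewrite exchange_big; apply: eq_bigr => u _ /=.
rewrite exchange_big; apply: eq_bigr => v _ /=.
rewrite -mulr_suml -mulr_sumr; congr (_ * _ * _).
(* Fixing the shape at j and leaving the others free is one constraint per factor, so the sum
   factorises; away from j the idempotents add up to the identity. *)
pose Q i : pred (partn m) := fun c => (i == j) ==> (c == nu).
pose F i (c : partn m) := rmx (iso_idem R m (ssval c)) (u i) (v i).
transitivity (\prod_i \sum_(c | Q i c) F i c).
  rewrite (bigA_distr_big_dep Q F); apply: eq_bigl => L.
  apply/idP/familyP => [/eqP Lj i|LQ].
    by rewrite unfold_in /Q; apply/implyP => /eqP ->; rewrite Lj.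
  by have := LQ j; rewrite unfold_in /Q eqxx.
rewrite (bigD1 j) //=; congr (_ * _).
  by rewrite (big_pred1 nu) // => c; rewrite /Q eqxx.
transitivity (\prod_(i | i != j) (u i == v i)%:R : C).
  apply: eq_bigr => i ij; rewrite (eq_bigl xpredT); last first.
    by move=> c; rewrite /Q (negPf ij).
  by rewrite /F -rmx_sum sum_iso_idem rmx1.
rewrite big_mkcond /agree_off -prod_bool; apply: eq_bigr => i _.
by case: (i != j).
Qed.

Lemma sum_all_iso_weight t m (j : 'I_k) : t != 0 ->
  \sum_(L : {ffun 'I_k -> partn m}) iso_weight t L = sqnorm t ^+ m.
Proof.
move=> t0; have [r0 r1] := spectrum_dist j t0.
rewrite (partition_big (fun L : {ffun 'I_k -> partn m} => L j) xpredT) //=.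
under eq_bigr => nu _ do rewrite sum_iso_weight //.
rewrite -mulr_sumr exchange_big /=.
have one (w : word m (n j)) : \sum_(nu : partn m) iso_diag R (ssval nu) w = 1.
  apply: rc_inj; rewrite rc_sum; under eq_bigr => nu _ do rewrite -iso_diagE.
  by rewrite -rmx_sum sum_iso_idem rmx1 eqxx.
under eq_bigr => w _ do rewrite -mulr_suml one mul1r.
rewrite -(bigA_distr_bigA (fun (_ : 'I_m) y => spectrum t y)) /=.
by rewrite big1 ?mulr1.
Qed.

End LowerLeUpper.

Lemma card_short_partitions (m d : nat) :
  (#|[pred nu : partn m | size (ssval nu) <= d]| <= m.+1 ^ d)%N.
Proof.
pose f (nu : partn m) : {ffun 'I_d -> 'I_m.+1} :=
  [ffun i : 'I_d => inord (nth 0%N (ssval nu) i)].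
have f_inj : {in [pred nu : partn m | size (ssval nu) <= d]%N &, injective f}.
  move=> nu mu; rewrite !inE => snu smu eq_f; apply: val_inj.
  apply: (@dominates_anti m); rewrite ?partnP // => i; apply: eq_leq;
    apply: eq_bigr => r _;
  have [dr|rd] := leqP d r;
    try (by rewrite !nth_default // (leq_trans _ dr));
    have := congr1 (fun g : {ffun 'I_d -> 'I_m.+1} => val (g (Ordinal rd))) eq_f;
    rewrite !ffunE /= !inordK ?ltnS ?(partition_nth_le _ (partnP _)) //.
rewrite -(card_in_imset f_inj); apply: leq_trans (max_card _) _.
by rewrite card_ffun !card_ord.
Qed.

(** * Selecting shapes of large entropy *)

Section QuantumFunctionals.
Variables (R : realType) (k : nat) (n : 'I_k -> nat).
Local Notation C := (R[i]).
Implicit Types (t : tensor R n) (m : nat).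

Definition shape_entropy m (lam : seq nat) : R :=
  nats_entropy (fun i : 'I_(size lam) => (nth 0%N lam i)%:R / m%:R).

Lemma good_shapes_exist t (del : R) : (0 < k)%N -> t != 0 -> 0 < del ->
  exists m (L : {ffun 'I_k -> partn m}), [/\ (0 < m)%N, iso_component t L != 0 &
    forall j, nats_entropy (spectrum t (j := j)) - 2 * del <=
      shape_entropy m (ssval (L j))].
Proof.
move=> k0 t0 del0; pose j0 := Ordinal k0.
pose K j := \sum_x spectrum t (j := j) x * ln (spectrum t x) ^+ 2.
have K0 j : 0 <= K j.
  by apply: sumr_ge0 => x _; rewrite mulr_ge0 ?sqr_ge0 //;
    have [] := spectrum_dist j t0.
pose Kt := \sum_j K j.
have Kt0 : 0 <= Kt by apply: sumr_ge0 => j _.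
have KKt j : K j <= Kt by rewrite /Kt (bigD1 j) //= lerDl sumr_ge0.
(* One tilt for all factors: [Kt] bounds every second moment [K j]. *)
pose s := Num.min 1 (del / 2 / (Kt + 1)).
have s0 : 0 < s by rewrite lt_min ltr01 /= !divr_gt0 // ltr_wpDl.
have s1 : s <= 1 by rewrite ge_min lexx.
have sK j : s * K j <= del / 2.
  apply: (@le_trans _ _ (del / 2 / (Kt + 1) * (Kt + 1))).
    apply: ler_pM => //; first exact: ltW.
      by rewrite ge_min lexx orbT.
    by apply: le_trans (KKt j) _; rewrite lerDl.
  by rewrite divfK // gt_eqF // ltr_wpDl.
pose c := s * del / 2.
have c0 : 0 < c by rewrite !divr_gt0 // mulr_gt0.
pose dm := (\max_j n j)%N.
(* The degree collects dm * dm from the rank bound and dm from the number of shapes; 2k comes from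
   the two halves of [rare_shape] and the k factors. *)
have [m m0 small] := poly_lt_exp (dm * dm + dm) (ler0n R (2 * k)) c0.
exists m; apply: contrapT => noL.
have N0 := sqnorm_gt0 t0.
pose bad j (nu : partn m) :=
  shape_entropy m (ssval nu) < nats_entropy (spectrum t (j := j)) - 2 * del.
have w0 (L : {ffun 'I_k -> partn m}) : 0 <= iso_weight t L.
  by apply: sumr_ge0 => a _; apply: sqmod_ge0.
(* Union bound under the assumption [noL]: a tuple of nonzero weight has a bad shape in some
   factor. *)
have cover (L : {ffun 'I_k -> partn m}) :
    iso_weight t L <= \sum_j (if bad j (L j) then iso_weight t L else 0).
  have [iL|iL] := eqVneq (iso_component t L) 0.
    rewrite {1}/iso_weight iL /sqnorm big1 => [|a _]; last first.
      by apply/eqP; rewrite sqmod_eq0 ffunE.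
    by apply: sumr_ge0 => j _; case: ifP.
  have [/existsP [j jb]|/existsPn good] := boolP [exists j, bad j (L j)].
    rewrite (bigD1 j) //= jb lerDl; apply: sumr_ge0 => i _; by case: ifP.
  case: noL; exists L; split=> // j; rewrite leNgt; exact: good.
have rare j (nu : partn m) : bad j nu ->
    \sum_(w : word m (n j)) iso_diag R (ssval nu) w * \prod_x spectrum t (j := j) (w x) <=
    2 * (m.+1%:R ^+ (dm * dm) * expR (- (m%:R * c))).
  move=> jb; apply: le_trans (rare_shape (spectrum_dist j t0) m0 (partnP nu)
    del0 s0 s1 (sK j) jb) _.
  rewrite ler_pM2l // ler_wpM2r ?expR_ge0 // ler_weXn2l ?ler1n //.
  by rewrite leq_mul // leq_bigmax.
have rare0 j (nu : partn m) : (n j < size (ssval nu))%N ->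
    \sum_(w : word m (n j)) iso_diag R (ssval nu) w * \prod_x spectrum t (j := j) (w x) = 0.
  by move=> tall; rewrite big1 // => w _; rewrite iso_diag_tall ?mul0r ?partnP.
pose B : R := 2 * (m.+1%:R ^+ (dm * dm) * expR (- (m%:R * c))).
have B0 : 0 <= B by rewrite !mulr_ge0 ?exprn_ge0 ?expR_ge0.
have total : sqnorm t ^+ m <= sqnorm t ^+ m * (k%:R * (m.+1%:R ^+ dm * B)).
  rewrite -{1}(sum_all_iso_weight m j0 t0).
  apply: le_trans (ler_sum _ (fun L _ => cover L)) _.
  rewrite exchange_big /= -[k in k%:R]card_ord -sum1_card natr_sum mulr_suml mulr_sumr.
  apply: ler_sum => j _; rewrite mul1r.
  rewrite (partition_big (fun L : {ffun 'I_k -> partn m} => L j) xpredT) //=.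
  have -> : \sum_(nu : partn m) \sum_(L : {ffun 'I_k -> partn m} | L j == nu)
      (if bad j (L j) then iso_weight t L else 0) =
    \sum_(nu : partn m | bad j nu) sqnorm t ^+ m *
      \sum_(w : word m (n j)) iso_diag R (ssval nu) w * \prod_x spectrum t (j := j) (w x).
    rewrite [RHS]big_mkcond; apply: eq_bigr => nu _; rewrite -sum_iso_weight //.
    case: ifP => b.
      by apply: eq_bigr => L /eqP ->; rewrite b.
    by rewrite big1 // => L /eqP ->; rewrite b.
  rewrite -mulr_sumr ler_wpM2l ?exprn_ge0 ?(ltW N0) //.
  apply: (@le_trans _ _ (\sum_(nu : partn m | (size (ssval nu) <= n j)%N) B)).
    rewrite big_mkcond [leRHS]big_mkcond; apply: ler_sum => nu _ /=.
    case: ifP => [b|_]; case: leqP => // sn; [exact: rare | by rewrite rare0].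
  rewrite sumr_const -[leLHS]mulr_natl; apply: ler_wpM2r => //.
  rewrite -natrX ler_nat.
  apply: leq_trans (card_short_partitions m (n j)) _.
  by rewrite leq_exp2l // leq_bigmax.
have : sqnorm t ^+ m * (k%:R * (m.+1%:R ^+ dm * B)) < sqnorm t ^+ m * 1.
  rewrite ltr_pM2l ?exprn_gt0 //; apply: le_lt_trans small.
  by rewrite /B exprD natrM le_eqVlt; apply/orP; left; apply/eqP; ring.
by rewrite mulr1 ltNge total.
Qed.

Lemma lower_quantum_le_upper (theta : 'I_k -> R) t : (0 < k)%N -> is_dist theta ->
  (lower_quantum theta t <= upper_quantum theta t)%E.
Proof.
move=> k0 [theta0 theta1]; apply: ge_ereal_sup => _ [A [Au psi0 ->]].
set psi := tmap _ t in psi0 *.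
apply/lee_addgt0Pr => eps eps0; have l2 := ln2_gt0 R.
(* The shapes lose up to 2 del in natural units, which is eps after division by ln 2. *)
pose del := eps * ln 2 / 2.
have del0 : 0 < del by rewrite divr_gt0 // mulr_gt0.
have [m [L [m0 comp0 ent]]] := good_shapes_exist k0 psi0 del0.
apply: (@le_trans _ _ ((\sum_j theta j * part_entropy R m (ssval (L j)))%:E + eps%:E)%E).
  rewrite -EFinD lee_fin -[eps]mul1r -theta1 mulr_suml -big_split /=.
  apply: ler_sum => j _; rewrite -mulrDr ler_wpM2l //.
  rewrite -[vn_entropy _]/(entropy (spectrum psi (j := j))) /part_entropy !entropyE.
  rewrite ler_pdivrMr // mulrDl divfK ?gt_eqF //.
  have := ent j; rewrite /shape_entropy /del; lra.
rewrite leeD2r //; apply: ereal_sup_ubound.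
exists m, (fun j => ssval (L j)), (fun j => linfun (gact (iso_idem R m (ssval (L j))))).
split=> //.
- by move=> j; apply: partnP.
- by move=> j; apply: iso_idem_proj; apply: partnP.
(* The projections commute with the m-th tensor powers of the [A j], so a nonzero component of [psi]
   comes from a nonzero component of [t] itself. *)
apply: contra_neq comp0 => z0; rewrite /iso_component /psi tens_pow_tmap tmap_comp.
rewrite (eq_tmap (B := fun j x z => \sum_y mpow (A j) x y *
    rmx (iso_idem R m (ssval (L j))) y z)); last first.
  by move=> j x z; apply: rmx_commute => s v v'; apply: mpow_act.
rewrite -tmap_comp -[RHS](tmap0 (fun j => mpow (A j))); congr (tmap _ _).
rewrite -[RHS]z0.
apply: eq_tmap => j x z; rewrite (end_entry_gact (x := iso_idem R m (ssval (L j)))) //.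
by move=> v; rewrite lfunE.
Qed.

End QuantumFunctionals.

Theorem theorem4p20 (R : realType) (k : nat) (hk : (3 <= k)%N)
    (n : 'I_k -> nat) (t : tensor R n) (ht : free_tensor t)
    (theta : 'I_k -> R) (htheta : is_dist theta) :
  upper_support theta t = upper_quantum theta t /\
  upper_quantum theta t = lower_quantum theta t.
Proof.
have [theta0 _] := htheta; have [B [Bb Bf]] := ht.
have k0 : (0 < k)%N by apply: leq_trans hk.
have low : (upper_support theta t <= lower_quantum theta t)%E.
  apply: le_trans (max_entropy_le_lower theta0 Bb Bf).
  by apply: ereal_inf_lbound; exists B.
have mid := lower_quantum_le_upper t k0 htheta.
have up : (upper_quantum theta t <= upper_support theta t)%E.
  apply: le_ereal_inf_tmp => _ [B' B'b <-].
  exact: upper_quantum_le_support.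
by split; apply/eqP; rewrite eq_le ?(le_trans low mid) ?(le_trans up low) ?up ?mid.
Qed.
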